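(* Let $X$ be a complex Banach space with open unit ball $\mathbb{B}$. Let $f$ be an $X$-valued mapping holomorphic in a neighborhood of the origin of $X$ and represented there by the series of homogeneous polynomials $f(x)=x+\sum_{k=2}^\infty P_k(x)$, and let $g=f^{-1}$ be its inverse mapping (defined in a neighborhood of the origin). Then for all $\lambda,\mu\in\mathbb{C}$, $e\in\partial\mathbb{B}$ and $e^*\in J(e)$, $$\Psi_e(f^{-1},\lambda,\mu)=-\Psi_e(f,2-\lambda,2-\mu).$$ In addition, for any $x\in X$, $x\neq0$, $$\frac1{3!}D^3g(0)[x^3]=-\|x\|^3\cdot\Psi_e(f,2,2),\quad\text{where } e=\frac{1}{\|x\|}x.$$
   Context: Notation: $X^*$ is the dual space with pairing $\langle x,a\rangle$, $J(x)=\{x^*\in X^*:\|x^*\|=\|x\|,\ \langle x,x^*\rangle=\|x\|^2\}$. $D^kf(0)$ is the $k$-th Fréchet derivative at $0$ (bounded symmetric $k$-linear operator), and $P_k(x)=\frac1{k!}D^kf(0)[x^k]$. Fekete–Szegő mapping: for $f(x)=x+\sum_{k\ge2}P_k(x)$ holomorphic near $0$, $$\Psi_e(f,\lambda,\mu)=P_3(e)-\frac{\mu}{2}D^2f(0)[e,P_2(e)]-(\lambda-\mu)\langle P_2(e),e^*\rangle P_2(e).$$ (When $\lambda=\mu$ it does not depend on the choice of $e^*\in J(e)$.) *)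

(* Defs.v *)
From HB Require Import structures.
From mathcomp Require Import all_boot all_order all_algebra.
From mathcomp Require Import complex.
From mathcomp Require Import all_classical all_reals all_analysis.

Set Implicit Arguments.
Unset Strict Implicit.
Unset Printing Implicit Defensive.

Import Order.TTheory GRing.Theory Num.Theory.
Import numFieldNormedType.Exports.

Local Open Scope classical_set_scope.
Local Open Scope ring_scope.

Section BoundedLinear.
Context {R : realType}.
Variables V W : normedModType R[i].

Definition blin_pred : {pred V -> W} :=
  mem [set T : V -> W | linear T /\ continuous T].

(** The space L(V, W) of bounded linear operators. *)
Record blin := Blin { blin_fun :> V -> W; _ : blin_fun \in blin_pred }.

HB.instance Definition _ := [isSub for blin_fun].
HB.instance Definition _ := [Choice of blin by <:].

Lemma blin_submod_closed : submod_closed blin_pred.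
Proof.
split.
  by rewrite inE; split; [move=> a u v; rewrite scaler0 addr0
                         |exact: cst_continuous].
move=> a S T; rewrite !inE => -[lS cS] [lT cT]; split.
  move=> b u v; rewrite !fctE lS lT !scalerDr !scalerA mulrC -!addrA.
  by congr (_ + _); rewrite addrCA.
move=> x; apply: cvgD; last exact: cT.
by apply: cvgZl_tmp; exact: cS.
Qed.

HB.instance Definition _ :=
  GRing.isSubmodClosed.Build R[i] (V -> W) blin_pred blin_submod_closed.
HB.instance Definition _ := [SubChoice_isSubLmodule of blin by <:].
End BoundedLinear.

Section OperatorNorm.
Context {R : realType}.
Variables V W : normedModType R[i].
Implicit Types T : blin V W.

Lemma blinP T : linear (T : V -> W) /\ continuous (T : V -> W).
Proof. by case: T => T /=; rewrite inE. Qed.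

HB.instance Definition _ T :=
  GRing.isLinear.Build R[i] V W _ (blin_fun T) (blinP T).1.

Lemma blin_continuous T : continuous (T : V -> W).
Proof. exact: (blinP T).2. Qed.

(* In a normed space over [R[i]] the norm is an element of [R[i]]. *)
Definition opnorm_set T : set R :=
  [set complex.Re `|T x| | x in [set x : V | `|x| <= 1]].

Definition opnorm T : R[i] := (sup (opnorm_set T))%:C%C.

Lemma Re_norm (U : normedModType R[i]) (u : U) : (complex.Re `|u|)%:C%C = `|u|.
Proof. by rewrite RRe_real// normr_real. Qed.

Lemma opnorm_set_has_sup T : has_sup (opnorm_set T).
Proof.
split; first by exists (complex.Re `|T 0|), 0; rewrite //= normr0.
have /linear_boundedP/pinfty_ex_gt0[r r0 Tr] :=
  continuous_linear_bounded 0 (@blin_continuous T 0).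
exists (complex.Re r) => _ [x /= x1 <-]; rewrite -lecR Re_norm RRe_real ?gtr0_real//.
by rewrite (le_trans (Tr x))// ger_pMr.
Qed.

Lemma le_opnorm T x : `|T x| <= opnorm T * `|x|.
Proof.
have [->|x0] := eqVneq x 0; first by rewrite linear0 !normr0 mulr0.
have nx0 : 0 < `|x| by rewrite normr_gt0.
have -> : `|T x| = `|T (`|x|^-1 *: x)| * `|x|.
  by rewrite linearZ/= normrZ normfV normr_id mulrAC mulVf ?mul1r// gt_eqF.
rewrite ler_pM2r// -[leLHS]Re_norm lecR.
apply: sup_upper_bound; [exact: opnorm_set_has_sup|]; exists (`|x|^-1 *: x) => //=.
by rewrite normrZ normfV normr_id mulVf// gt_eqF.
Qed.

Lemma opnorm_le T (M : R[i]) :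
  (forall x, `|x| <= 1 -> `|T x| <= M) -> opnorm T <= M.
Proof.
move=> TM; have M0 : 0 <= M.
  by rewrite (le_trans _ (TM 0 _))// ?normr0.
rewrite /opnorm -[leRHS]RRe_real ?ger0_real// lecR.
apply: ge_sup; first by have [] := opnorm_set_has_sup T.
by move=> _ [x /= x1 <-]; rewrite -lecR Re_norm RRe_real ?ger0_real//; exact: TM.
Qed.

Lemma opnorm_ge0 T : 0 <= opnorm T.
Proof.
rewrite /opnorm lecR; apply: sup_upper_bound; first exact: opnorm_set_has_sup.
by exists 0; rewrite /= ?normr0// linear0 normr0.
Qed.

Lemma opnormD S T : opnorm (S + T) <= opnorm S + opnorm T.
Proof.
apply: opnorm_le => x x1; rewrite (le_trans (ler_normD _ _))// lerD//.
  by rewrite (le_trans (le_opnorm _ _))// ler_piMr ?opnorm_ge0.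
by rewrite (le_trans (le_opnorm _ _))// ler_piMr ?opnorm_ge0.
Qed.

Lemma opnormZ_le (a : R[i]) T : opnorm (a *: T) <= `|a| * opnorm T.
Proof.
apply: opnorm_le => x x1; rewrite [leLHS]normrZ ler_wpM2l//.
by rewrite (le_trans (le_opnorm _ _))// ler_piMr ?opnorm_ge0.
Qed.

Lemma opnormZ (a : R[i]) T : opnorm (a *: T) = `|a| * opnorm T.
Proof.
apply/eqP; rewrite eq_le opnormZ_le/=.
have [->|a0] := eqVneq a 0; first by rewrite normr0 mul0r opnorm_ge0.
rewrite -ler_pdivlMl ?normr_gt0// -normfV.
by rewrite -[in leLHS](scale1r T) -(mulVf a0) -scalerA opnormZ_le.
Qed.

Lemma opnorm0_eq0 T : opnorm T = 0 -> T = 0.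
Proof.
move=> T0; apply/val_inj/funext => x; apply/normr0_eq0/le_anti.
by rewrite normr_ge0 (le_trans (le_opnorm T x))// T0 mul0r.
Qed.

HB.instance Definition _ :=
  @Lmodule_isNormed.Build R[i] (blin V W) opnorm opnormD opnormZ opnorm0_eq0.

Lemma blin_normE T : `|T| = opnorm T.
Proof. by []. Qed.
End OperatorNorm.

Section Dual.
Context {R : realType}.

Definition dual (X : normedModType R[i]) := blin X R[i]^o.

Definition duality (X : normedModType R[i]) (x : X) : set (dual X) :=
  [set xs : dual X | `|xs| = `|x| /\ xs x = `|x| ^+ 2].
End Dual.

Section FrechetDerivatives.
Context {R : realType}.

(* The differential as an element of L(V, W); 0 at points where [f] is not
   differentiable. *)
Definition dblin (V W : normedModType R[i]) (f : V -> W) (x : V) : blin V W :=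
  if pselect (differentiable f x) is left df
  then Blin (mem_set (conj (linearP ('d f x)) (diff_continuous df)))
  else 0.

Variable X : normedModType R[i].

(** [mlin k] is L(X, L(X, ... L(X, X))), the space of bounded k-linear
    operators on X, and [mlin_app] its evaluation at a k-tuple of vectors. *)
Fixpoint mlin (k : nat) : normedModType R[i] :=
  if k is k'.+1 then blin X (mlin k') else X.

Fixpoint mlin_app (k : nat) : mlin k -> k.-tuple X -> X :=
  if k is k'.+1 then fun T v => mlin_app ((T : blin X (mlin k')) (thead v))
                                         [tuple of behead v]
  else fun T _ => T.

Fixpoint frechet (k : nat) (f : X -> X) : X -> mlin k :=
  if k is k'.+1 then dblin (frechet k' f) else f.

Definition nderiv k f (a : X) (v : k.-tuple X) : X := mlin_app (frechet k f a) v.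

Definition taylor_poly (f : X -> X) (k : nat) (x : X) : X :=
  (k`!)%:R^-1 *: nderiv f 0 [tuple of nseq k x].

(* Maps defined near the origin are total functions on X of which only the
   behaviour near 0 is used. *)
Definition holomorphic_near0 (f : X -> X) : Prop :=
  \forall x \near 0, differentiable f x.

Definition normalized_expansion (f : X -> X) : Prop :=
  \forall x \near 0,
    (fun n => x + \sum_(2 <= k < n) taylor_poly f k x) @ \oo --> f x.

Definition local_inverse (f g : X -> X) : Prop :=
  exists U V : set X,
    [/\ open_nbhs 0 U, open_nbhs 0 V, set_bij U V f & {in U, cancel f g}].

(* The functional [es] stands for the chosen e^* in J(e); its coefficient
   vanishes when lambda = mu. *)
Definition fekete_szego (f : X -> X) (lambda mu : R[i]) (e : X) (es : dual X) :=
  taylor_poly f 3 e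
  - (mu / 2) *: nderiv f 0 [tuple e; taylor_poly f 2 e]
  - ((lambda - mu) * es (taylor_poly f 2 e)) *: taylor_poly f 2 e.
End FrechetDerivatives.

(* Main.v *)
Require Import Defs.
From HB Require Import structures.
From mathcomp Require Import all_boot all_order all_algebra.
From mathcomp Require Import cyclic separable cyclotomic complex ring.
From mathcomp Require Import all_classical all_reals all_analysis.

Import Order.TTheory GRing.Theory Num.Theory.
Import numFieldNormedType.Exports.

Local Open Scope classical_set_scope.
Local Open Scope ring_scope.

Set Implicit Arguments.
Unset Strict Implicit.
Unset Printing Implicit Defensive.

(* Scaling a point by a complex unit and averaging over roots of unity turns the
   pointwise convergence of the series [x + P_2(x) + ...] together with the local
   boundedness of [f] into the bounds |P_k(x)| <= M (c |x|)^k. Hence [f] is near 0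
   a uniform limit of polynomial maps, and Cauchy estimates make the derivatives of
   these polynomial maps converge uniformly to those of [f] (Weierstrass); so [f] is
   infinitely differentiable near 0 and its second derivative is symmetric. The
   inverse [g] is the uniform limit of the polynomial maps
   G_{n+1}(y) = y - (S_n - id)(G_n(y)), with [S_n] the partial sums of [f], so the
   same applies to it. Differentiating [g (f x) = x] three times at 0 gives
   D^2 g(0) = - D^2 f(0) and
   D^3 g(0)[w^3] = 3 D^2 f(0)[w, D^2 f(0)[w, w]] - D^3 f(0)[w^3]. *)

(** Averaging over finitely many roots of unity recovers coefficients exactly only for polynomials
    in [t]. This is why every estimate is made on maps whose restriction to each complex line is
    polynomial, and reaches [f] and [g] only through uniform limits. Two obstacles shape the rest.
    [dblin] is 0 by default at points of non-differentiability, so differentiating [g (f x) = x] is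
    meaningful only once [g] is known to be three times differentiable at 0. One derivative of the
    inverse would not suffice, and the approximation of [g] by polynomial maps supplies all of them
    by the same theorem as for [f]. Secondly, the operators [frechet k f 0] are not symmetric by
    construction, while the third derivative of the identity produces D^2 f(0)[D^2 f(0)[w, w], w]
    with its slots in the wrong order. Symmetry is therefore proved for the polynomial approximants,
    where the product rule gives it, and passed to the limit at 0. *)

(** * Bounded linear and bilinear maps, and the rules of differentiation *)

Section BoundedOperators.
Context {R : realType}.
Implicit Types V W P Q : normedModType R[i].

Lemma blin0E V W (x : V) : (0 : blin V W) x = 0.
Proof. by []. Qed.

Lemma blinDE V W (S T : blin V W) x : (S + T) x = S x + T x.
Proof. by []. Qed.

Lemma blinNE V W (T : blin V W) x : (- T) x = - T x.
Proof. by []. Qed.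

Lemma blinZE V W a (T : blin V W) x : (a *: T) x = a *: T x.
Proof. by []. Qed.

Lemma blin_ext V W (S T : blin V W) : (forall x, S x = T x) -> S = T.
Proof. by move=> ST; apply/val_inj/funext. Qed.

Lemma blin_norm V W (T : blin V W) x : `|T x| <= `|T| * `|x|.
Proof. exact: le_opnorm. Qed.

Lemma blin_norm_le V W (T : blin V W) (M : R[i]) :
  (forall x, `|x| <= 1 -> `|T x| <= M) -> `|T| <= M.
Proof. exact: opnorm_le. Qed.

Lemma bounded_linear_blin V W (T : V -> W) :
  linear T -> (exists C : R[i], forall x, `|T x| <= C * `|x|) ->
  T \in @blin_pred R V W.
Proof.
move=> lT [C TC]; rewrite inE; split=> // x.
pose L := GRing.isLinear.Build _ _ _ _ _ lT.
pose T' : {linear V -> W} := HB.pack T L.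
apply: (@bounded_linear_continuous _ _ _ T').
apply/ex_bound; exists `|C|; apply/nbhs_norm0P; exists 1 => //= y /= y1.
have C0 : 0 <= C * `|y| by rewrite (le_trans _ (TC y)).
rewrite (le_trans (TC y))// -(ger0_norm C0) normrM normr_id.
by rewrite ler_piMr// ltW.
Qed.

Definition mkblin V W (T : V -> W) (lT : linear T)
    (bT : exists C : R[i], forall x, `|T x| <= C * `|x|) : blin V W :=
  Blin (bounded_linear_blin lT bT).

(** Evaluation and composition of operators are both instances, so a single product rule serves for
    all expressions met below. *)
Record bbil P Q W := Bbil {
  bbil_fun :> P -> Q -> W;
  bbil_linl : forall q, linear (bbil_fun^~ q);
  bbil_linr : forall p, linear (bbil_fun p);
  bbil_bound : exists C : R[i], 0 <= C /\
    forall p q, `|bbil_fun p q| <= C * (`|p| * `|q|) }.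

Section bbil_theory.
Variables (P Q W : normedModType R[i]) (B : bbil P Q W).

Lemma bbilDl p p' q : B (p + p') q = B p q + B p' q.
Proof. by have := bbil_linl B q 1 p p'; rewrite !scale1r. Qed.

Lemma bbilDr p q q' : B p (q + q') = B p q + B p q'.
Proof. by have := bbil_linr B p 1 q q'; rewrite !scale1r. Qed.

Lemma bbil0l q : B 0 q = 0.
Proof. by apply: (addrI (B 0 q)); rewrite -bbilDl !addr0. Qed.

Lemma bbil0r p : B p 0 = 0.
Proof. by apply: (addrI (B p 0)); rewrite -bbilDr !addr0. Qed.

Lemma bbilZl a p q : B (a *: p) q = a *: B p q.
Proof. by have := bbil_linl B q a p 0; rewrite bbil0l !addr0. Qed.

Lemma bbilZr a p q : B p (a *: q) = a *: B p q.
Proof. by have := bbil_linr B p a q 0; rewrite bbil0r !addr0. Qed.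

Lemma bbilNl p q : B (- p) q = - B p q.
Proof. by rewrite -scaleN1r bbilZl scaleN1r. Qed.

Lemma bbilNr p q : B p (- q) = - B p q.
Proof. by rewrite -scaleN1r bbilZr scaleN1r. Qed.

Section currying.
Variable V : normedModType R[i].

Fact bbil_compl_linear (A : blin V P) q : linear (fun v => B (A v) q).
Proof. by move=> a u v; rewrite linearP bbilDl bbilZl. Qed.

Fact bbil_compl_bound (A : blin V P) q :
  exists C : R[i], forall v, `|B (A v) q| <= C * `|v|.
Proof.
have [C [C0 BC]] := bbil_bound B.
exists (C * `|A| * `|q|) => v; rewrite (le_trans (BC _ _))//.
rewrite -!mulrA ler_wpM2l// [leRHS]mulrCA [leLHS]mulrC ler_wpM2l//.
exact: blin_norm.
Qed.

Definition bbil_compl_fun A q : blin V W :=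
  mkblin (bbil_compl_linear A q) (bbil_compl_bound A q).

Fact bbil_compl_linl q : linear (bbil_compl_fun^~ q).
Proof. by move=> a S T; apply: blin_ext => v; rewrite /= bbilDl bbilZl. Qed.

Fact bbil_compl_linr A : linear (bbil_compl_fun A).
Proof. by move=> a S T; apply: blin_ext => v; rewrite /= bbilDr bbilZr. Qed.

Fact bbil_compl_bounded : exists C : R[i], 0 <= C /\
  forall A q, `|bbil_compl_fun A q| <= C * (`|A| * `|q|).
Proof.
have [C [C0 BC]] := bbil_bound B; exists C; split=> // A q.
apply: blin_norm_le => v v1; rewrite (le_trans (BC _ _))// ler_wpM2l//.
rewrite ler_wpM2r// (le_trans (blin_norm _ _))// ler_piMr//.
Qed.

(** With its right-hand counterpart [bbil_compr], this is one half of the product rule for [B]. Both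
    halves are again bounded bilinear, so the derivative of a product can be differentiated by the
    same rule. *)
Definition bbil_compl : bbil (blin V P) Q (blin V W) :=
  Bbil bbil_compl_linl bbil_compl_linr bbil_compl_bounded.

Fact bbil_compr_linear p (A : blin V Q) : linear (fun v => B p (A v)).
Proof. by move=> a u v; rewrite linearP bbilDr bbilZr. Qed.

Fact bbil_compr_bound p (A : blin V Q) :
  exists C : R[i], forall v, `|B p (A v)| <= C * `|v|.
Proof.
have [C [C0 BC]] := bbil_bound B.
exists (C * `|p| * `|A|) => v; rewrite (le_trans (BC _ _))//.
by rewrite -!mulrA !ler_wpM2l// blin_norm.
Qed.

Definition bbil_compr_fun p A : blin V W :=
  mkblin (bbil_compr_linear p A) (bbil_compr_bound p A).

Fact bbil_compr_linl A : linear (bbil_compr_fun^~ A).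
Proof. by move=> a S T; apply: blin_ext => v; rewrite /= bbilDl bbilZl. Qed.

Fact bbil_compr_linr p : linear (bbil_compr_fun p).
Proof. by move=> a S T; apply: blin_ext => v; rewrite /= bbilDr bbilZr. Qed.

Fact bbil_compr_bounded : exists C : R[i], 0 <= C /\
  forall p A, `|bbil_compr_fun p A| <= C * (`|p| * `|A|).
Proof.
have [C [C0 BC]] := bbil_bound B; exists C; split=> // p A.
apply: blin_norm_le => v v1; rewrite (le_trans (BC _ _))// ler_wpM2l//.
rewrite ler_wpM2l// (le_trans (blin_norm _ _))// ler_piMr//.
Qed.

Definition bbil_compr : bbil P (blin V Q) (blin V W) :=
  Bbil bbil_compr_linl bbil_compr_linr bbil_compr_bounded.

End currying.
End bbil_theory.

Fact blin_eval_linl V W (x : V) : linear (fun T : blin V W => T x).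
Proof. by []. Qed.

Fact blin_eval_linr V W (T : blin V W) : linear (fun x : V => T x).
Proof. exact: (blinP T).1. Qed.

Fact blin_eval_bounded V W : exists C : R[i], 0 <= C /\
  forall (T : blin V W) (x : V), `|T x| <= C * (`|T| * `|x|).
Proof. by exists 1; split=> // T x; rewrite mul1r blin_norm. Qed.

Definition blin_eval V W : bbil (blin V W) V W :=
  Bbil (@blin_eval_linl V W) (@blin_eval_linr V W) (blin_eval_bounded V W).

Definition blin_comp V W P : bbil (blin W P) (blin V W) (blin V P) :=
  bbil_compr (blin_eval W P) V.

Fact blin_id_bound V : exists C : R[i], forall x : V, `|idfun x| <= C * `|x|.
Proof. by exists 1 => x; rewrite mul1r. Qed.

Definition blin_id V : blin V V :=
  mkblin (fun _ _ _ => erefl) (blin_id_bound V).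

(** The derivative is given in advance as an element of L(V, W), so the calculus rules compute
    [dblin] as an explicit operator, ready to be differentiated again. *)
Definition hasD V W (f : V -> W) (x : V) (T : blin V W) :=
  forall e : R[i], 0 < e ->
    \forall h \near (0 : V), `|f (x + h) - f x - T h| <= e * `|h|.

Lemma hasDP V W (f : V -> W) x T : hasD f x T <-> is_diff x f T.
Proof.
split=> [fT|[df dT]].
  have eT : f \o shift x = cst (f x) + T +o_ (0 : V) id.
    apply/eqaddoP => e e0; have := fT e e0; apply: filterS => h.
    by rewrite !fctE/= opprD addrA [h + x]addrC.
  have dT : 'd f x = T :> (V -> W).
    by apply: diff_unique => //; exact: blin_continuous.
  by split=> //; apply/diff_locallyP; rewrite dT; split=> //;
    exact: blin_continuous.
move=> e e0; have /eqaddoP/(_ e e0) := diff_locally df; rewrite dT.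
by apply: filterS => h; rewrite !fctE/= opprD addrA [h + x]addrC.
Qed.

Lemma dblinE V W (f : V -> W) x : differentiable f x ->
  dblin f x = 'd f x :> (V -> W).
Proof. by rewrite /dblin; case: pselect. Qed.

Lemma hasD_differentiable V W (f : V -> W) x T : hasD f x T -> differentiable f x.
Proof. by case/hasDP. Qed.

Lemma hasD_dblin V W (f : V -> W) x T : hasD f x T -> dblin f x = T.
Proof.
by move=> /hasDP[df dT]; apply: blin_ext => h; rewrite dblinE// dT.
Qed.

Lemma differentiable_hasD V W (f : V -> W) x :
  differentiable f x -> hasD f x (dblin f x).
Proof. by move=> df; apply/hasDP; split; rewrite ?dblinE. Qed.

Lemma hasD_cst V W (c : W) (x : V) : hasD (fun _ => c) x 0.
Proof. by apply/hasDP; exact: is_diff_cst. Qed.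

Lemma hasDD V W (f g : V -> W) x S T :
  hasD f x S -> hasD g x T -> hasD (fun y => f y + g y) x (S + T).
Proof. by move=> /hasDP fS /hasDP gT; apply/hasDP; exact: is_diffD. Qed.

Lemma hasDZ V W a (f : V -> W) x S :
  hasD f x S -> hasD (fun y => a *: f y) x (a *: S).
Proof. by move=> /hasDP fS; apply/hasDP; exact: is_diffZ. Qed.

Lemma hasD_blin V W (T : blin V W) x : hasD T x T.
Proof.
by move=> e e0; near=> h; rewrite linearD addrAC addrK subrr normr0 mulr_ge0// ltW.
Unshelve. all: by end_near. Qed.

Lemma hasD_comp V W P (p : W -> P) (q : V -> W) x S T :
  hasD q x S -> hasD p (q x) T ->
  hasD (fun y => p (q y)) x (blin_comp V W P T S).
Proof. by move=> /hasDP qS /hasDP pT; apply/hasDP; exact: is_diff_comp. Qed.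

Lemma hasD_near V W (f g : V -> W) x T :
  (\forall y \near x, f y = g y) -> hasD f x T -> hasD g x T.
Proof.
move=> fg fT e e0; have fx : f x = g x by exact: nbhs_singleton fg.
move/nbhs0P: fg (fT e e0); apply: filterS2 => h /= <-.
by rewrite fx.
Qed.

Lemma hasD_lipschitz V W (f : V -> W) x T : hasD f x T ->
  \forall h \near (0 : V), `|f (x + h) - f x| <= (`|T| + 1) * `|h|.
Proof.
move=> /(_ _ ltr01); apply: filterS => h fh.
rewrite -(subrK (T h) (_ - _)) (le_trans (ler_normD _ _))//.
by rewrite mulrDl addrC lerD// blin_norm.
Qed.

Lemma hasD_bbil V W P Q (B : bbil P Q W) (p : V -> P) (q : V -> Q) x S T :
  hasD p x S -> hasD q x T ->
  hasD (fun y => B (p y) (q y)) x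
       (bbil_compl B V S (q x) + bbil_compr B V (p x) T).
Proof.
move=> pS qT e e0.
have [C [C0 BC]] := bbil_bound B.
(* The remainder splits into three terms, bounded in [b1], [b2], [b3]; [K] collects their factors
   after [C * d * |h|] is taken out. The [+ 1] in [d] keeps the denominator positive when
   [C * K = 0]. *)
pose K := `|q x| + (`|T| + 1) + `|S| * (`|T| + 1) + `|p x|.
have K0 : 0 <= K by rewrite !addr_ge0// mulr_ge0// addr_ge0.
pose d := e / (C * K + 1).
have d0 : 0 < d by rewrite divr_gt0// ltr_wpDl// mulr_ge0.
have lq := hasD_lipschitz qT.
near=> h.
have hd : `|h| <= d by near: h; exact: nbhs0_le.
have h1 : `|h| <= 1 by near: h; exact: nbhs0_le.
have hq : `|q (x + h) - q x| <= (`|T| + 1) * `|h| by near: h.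
have hS : `|p (x + h) - p x - S h| <= d * `|h| by near: h; exact: pS.
have hT : `|q (x + h) - q x - T h| <= d * `|h| by near: h; exact: qT.
have -> : B (p (x + h)) (q (x + h)) - B (p x) (q x)
    - (bbil_compl B V S (q x) + bbil_compr B V (p x) T) h
  = B (p (x + h) - p x - S h) (q (x + h)) + B (S h) (q (x + h) - q x)
    + B (p x) (q (x + h) - q x - T h).
  rewrite blinDE/= !bbilDl !bbilNl !bbilDr !bbilNr subrKA.
  by rewrite opprD addrACA [X in _ = X + _]addrAC -[X in _ = _ + X]addrA subrKA.
have -> : e * `|h| = d * (C * K + 1) * `|h|.
  by rewrite divfK// gt_eqF// ltr_wpDl// mulr_ge0.
have hq' : `|q (x + h)| <= `|q x| + (`|T| + 1).
  rewrite -(subrK (q x) (q (x + h))) (le_trans (ler_normD _ _))// addrC lerD//.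
  by rewrite (le_trans hq)// ler_piMr// addr_ge0.
have d0' := ltW d0.
have b1 : `|B (p (x + h) - p x - S h) (q (x + h))| <=
    C * (d * `|h| * (`|q x| + (`|T| + 1))).
  by rewrite (le_trans (BC _ _))// ler_wpM2l// ler_pM.
have b2 : `|B (S h) (q (x + h) - q x)| <=
    C * ((`|S| * `|h|) * ((`|T| + 1) * d)).
  rewrite (le_trans (BC _ _))// ler_wpM2l// ler_pM// ?blin_norm//.
  by rewrite (le_trans hq)// ler_wpM2l// addr_ge0.
have b3 : `|B (p x) (q (x + h) - q x - T h)| <= C * (`|p x| * (d * `|h|)).
  by rewrite (le_trans (BC _ _))// !ler_wpM2l.
rewrite (le_trans (ler_normD _ _))//.
rewrite (le_trans (lerD (ler_normD _ _) (lexx _)))//.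
rewrite (le_trans (lerD (lerD b1 b2) b3))//.
rewrite [leLHS](_ : _ = C * K * d * `|h|); last by rewrite /K; ring.
by rewrite ler_wpM2r// [leLHS]mulrC ler_wpM2l ?lerDl// ltW.
Unshelve. all: by end_near. Qed.

End BoundedOperators.

(** * Polynomial curves, polynomial maps and symmetry of their second derivatives *)

Section PolynomialMaps.
Context {R : realType}.
Implicit Types V W P Q : normedModType R[i].

Inductive poly_curve W : (R[i] -> W) -> Prop :=
| poly_curve_mon n a : poly_curve (fun t => t ^+ n *: a)
| poly_curve_add c d :
    poly_curve c -> poly_curve d -> poly_curve (fun t => c t + d t).

Lemma poly_curve_cst W (a : W) : poly_curve (fun _ => a).
Proof.
by rewrite (_ : (fun _ => a) = fun t : R[i] => t ^+ 0 *: a);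
  [exact: poly_curve_mon|apply/funext => t; rewrite scale1r].
Qed.

Lemma poly_curve_line V (x v : V) : poly_curve (fun t => x + t *: v).
Proof. by apply: poly_curve_add; [exact: poly_curve_cst|exact: (poly_curve_mon 1)]. Qed.

Lemma poly_curveZ W a (c : R[i] -> W) :
  poly_curve c -> poly_curve (fun t => a *: c t).
Proof.
elim=> [n w|{}c d _ IHc _ IHd].
  under eq_fun do rewrite scalerA mulrC -scalerA.
  exact: poly_curve_mon.
under eq_fun do rewrite scalerDr.
exact: poly_curve_add.
Qed.

Lemma poly_curve_bbil P Q W (B : bbil P Q W) c d :
  poly_curve c -> poly_curve d -> poly_curve (fun t => B (c t) (d t)).
Proof.
move=> pc pd; elim: pc => [n a|{}c c' _ IHc _ IHc'].
  elim: pd => [m b|{}d d' _ IHd _ IHd'].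
    under eq_fun do rewrite bbilZl bbilZr scalerA -exprD.
    exact: poly_curve_mon.
  under eq_fun do rewrite bbilDr.
  exact: poly_curve_add.
under eq_fun do rewrite bbilDl.
exact: poly_curve_add.
Qed.

Lemma poly_curve_blin V W (T : blin V W) c :
  poly_curve c -> poly_curve (fun t => T (c t)).
Proof. exact: (poly_curve_bbil (blin_eval V W) (poly_curve_cst T)). Qed.

(** The coefficients are padded by zeros and every length [m >= n] is allowed: two curves can then
    be brought to a common length, and a user can ask for room for the coefficients of order 0 and
    1. *)
Lemma poly_curve_coef W (c : R[i] -> W) : poly_curve c ->
  exists n (a : nat -> W), forall m, (n <= m)%N ->
    forall t, c t = \sum_(i < m) t ^+ i *: a i.
Proof.
elim=> [n w|{}c d _ [n [a ca]] _ [m [b db]]].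
  exists n.+1, (fun i => if i == n then w else 0) => m nm t.
  rewrite (bigD1 (Ordinal nm))//= eqxx big1 ?addr0// => i.
  by rewrite -val_eqE/= => /negPf ->; rewrite scaler0.
exists (maxn n m), (fun i => a i + b i) => k; rewrite geq_max => /andP[nk mk] t.
by rewrite (ca _ nk) (db _ mk) -big_split; apply: eq_bigr => i _; rewrite scalerDr.
Qed.

(** Counting derivatives makes induction possible although the codomain changes from [W] to
    [blin V W] at each step. *)
Fixpoint poly_upto (k : nat) V W (p : V -> W) : Prop :=
  (forall c, poly_curve c -> poly_curve (fun t => p (c t))) /\
  if k is k'.+1
  then (forall x, differentiable p x) /\ poly_upto k' (dblin p) else True.

(* Stands for "continuous polynomial map": [p] is infinitely differentiable,
   and [p] and all its derivatives send polynomial curves to polynomial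
   curves. *)
Definition poly_map V W (p : V -> W) := forall k, poly_upto k p.

Lemma poly_upto_curve k V W (p : V -> W) c :
  poly_upto k p -> poly_curve c -> poly_curve (fun t => p (c t)).
Proof. by case: k => [|k] [+ _]; apply. Qed.

Lemma poly_uptoW k V W (p : V -> W) : poly_upto k.+1 p -> poly_upto k p.
Proof. by elim: k W p => [|k IH] W p [pc [dp /= Dp]]; split=> //; split=> //; exact: IH. Qed.

Lemma poly_upto_cst k V W (a : W) : poly_upto k (fun _ : V => a).
Proof.
elim: k W a => [|k IH] W a; first by split=> // c _; exact: poly_curve_cst.
split=> [c _|]; first exact: poly_curve_cst.
have D x : hasD (fun _ : V => a) x 0 by exact: hasD_cst.
split=> [x|]; first exact: hasD_differentiable (D x).
by rewrite (_ : dblin _ = fun=> 0)//; apply/funext => x; exact: hasD_dblin.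
Qed.

Lemma poly_upto_blin k V W (T : blin V W) : poly_upto k T.
Proof.
case: k => [|k]; first by split=> // c; exact: poly_curve_blin.
split=> [c|]; first exact: poly_curve_blin.
split=> [x|]; first exact: hasD_differentiable (hasD_blin T x).
rewrite (_ : dblin _ = fun=> T); first exact: poly_upto_cst.
by apply/funext => x; exact/hasD_dblin/hasD_blin.
Qed.

Lemma dblinD V W (p q : V -> W) x : differentiable p x -> differentiable q x ->
  dblin (fun y => p y + q y) x = dblin p x + dblin q x.
Proof. by move=> dp dq; exact/hasD_dblin/hasDD/differentiable_hasD/dq/differentiable_hasD. Qed.

Lemma dblinZ V W a (p : V -> W) x : differentiable p x ->
  dblin (fun y => a *: p y) x = a *: dblin p x.
Proof. by move=> dp; exact/hasD_dblin/hasDZ/differentiable_hasD. Qed.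

Lemma dblin_bbil V P Q W (B : bbil P Q W) (p : V -> P) (q : V -> Q) x :
  differentiable p x -> differentiable q x ->
  dblin (fun y => B (p y) (q y)) x =
  bbil_compl B V (dblin p x) (q x) + bbil_compr B V (p x) (dblin q x).
Proof.
by move=> dp dq; exact/hasD_dblin/hasD_bbil/differentiable_hasD/dq/differentiable_hasD.
Qed.

Lemma dblin_comp V W P (p : W -> P) (q : V -> W) x :
  differentiable q x -> differentiable p (q x) ->
  dblin (fun y => p (q y)) x = blin_comp V W P (dblin p (q x)) (dblin q x).
Proof.
by move=> dp dq; apply/hasD_dblin/hasD_comp; exact/differentiable_hasD.
Qed.

Lemma differentiable_bbil V P Q W (B : bbil P Q W) (p : V -> P) (q : V -> Q) x :
  differentiable p x -> differentiable q x ->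
  differentiable (fun y => B (p y) (q y)) x.
Proof.
by move=> /differentiable_hasD dp /differentiable_hasD dq; exact: hasD_differentiable (hasD_bbil B dp dq).
Qed.

Lemma poly_uptoD k V W (p q : V -> W) :
  poly_upto k p -> poly_upto k q -> poly_upto k (fun x => p x + q x).
Proof.
elim: k W p q => [|k IH] W p q pp pq.
  by split=> // c cc; exact: (poly_curve_add (poly_upto_curve pp cc) (poly_upto_curve pq cc)).
split=> [c cc|]; first by exact: (poly_curve_add (poly_upto_curve pp cc) (poly_upto_curve pq cc)).
case: pp pq => [_ [dp Dp]] [_ [dq Dq]].
split=> [x|]; first exact: (differentiableD (dp x) (dq x)).
rewrite (_ : dblin _ = fun x => dblin p x + dblin q x); first exact: IH.
by apply/funext => x; rewrite dblinD.
Qed.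

Lemma poly_uptoZ k V W a (p : V -> W) :
  poly_upto k p -> poly_upto k (fun x => a *: p x).
Proof.
elim: k W p => [|k IH] W p pp.
  by split=> // c cc; exact: (poly_curveZ _ (poly_upto_curve pp cc)).
split=> [c cc|]; first by exact: (poly_curveZ _ (poly_upto_curve pp cc)).
case: pp => [_ [dp Dp]]; split=> [x|]; first exact: (differentiableZ _ (dp x)).
rewrite (_ : dblin _ = fun x => a *: dblin p x); first exact: IH.
by apply/funext => x; rewrite dblinZ.
Qed.

(** The derivative of [B (p x) (q x)] is a sum of two expressions of the same form for the lifted
    bilinear maps, so the induction must range over all [B] and all spaces. *)
Lemma poly_upto_bbil k V P Q W (B : bbil P Q W) (p : V -> P) (q : V -> Q) :
  poly_upto k p -> poly_upto k q -> poly_upto k (fun x => B (p x) (q x)).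
Proof.
elim: k P Q W B p q => [|k IH] P Q W B p q pp pq.
  by split=> // c cc; exact: (poly_curve_bbil _ (poly_upto_curve pp cc) (poly_upto_curve pq cc)).
split=> [c cc|]; first by exact: (poly_curve_bbil _ (poly_upto_curve pp cc) (poly_upto_curve pq cc)).
have [pk qk] := (poly_uptoW pp, poly_uptoW pq).
case: pp pq => [_ [dp Dp]] [_ [dq Dq]].
split=> [x|]; first exact: differentiable_bbil.
rewrite (_ : dblin _ = fun x =>
  bbil_compl B V (dblin p x) (q x) + bbil_compr B V (p x) (dblin q x)).
  by apply: poly_uptoD; exact: IH.
by apply/funext => x; rewrite dblin_bbil.
Qed.

Lemma poly_upto_comp k V W P (p : W -> P) (q : V -> W) :
  poly_upto k p -> poly_upto k q -> poly_upto k (fun x => p (q x)).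
Proof.
elim: k P p => [|k IH] P p pp pq.
  by split=> // c cc; exact: (poly_upto_curve pp (poly_upto_curve pq cc)).
split=> [c cc|].
  by exact: (poly_upto_curve pp (poly_upto_curve pq cc)).
have qk := poly_uptoW pq.
case: pp pq => [_ [dp Dp]] [_ [dq Dq]].
split=> [x|]; first exact: (differentiable_comp (dq x) (dp _)).
rewrite (_ : dblin _ = fun x => blin_comp V W P (dblin p (q x)) (dblin q x)).
  by apply: poly_upto_bbil => //; exact: IH.
by apply/funext => x; rewrite dblin_comp.
Qed.

Lemma poly_map_curve V W (p : V -> W) c :
  poly_map p -> poly_curve c -> poly_curve (fun t => p (c t)).
Proof. by move=> /(_ 0%N); exact: poly_upto_curve. Qed.

Lemma poly_map_differentiable V W (p : V -> W) x :
  poly_map p -> differentiable p x.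
Proof. by case/(_ 1%N) => _ []. Qed.

Lemma poly_map_dblin V W (p : V -> W) : poly_map p -> poly_map (dblin p).
Proof. by move=> pp k; case: (pp k.+1) => _ []. Qed.

Lemma poly_map_cst V W (a : W) : poly_map (fun _ : V => a).
Proof. by move=> k; exact: poly_upto_cst. Qed.

Lemma poly_map_blin V W (T : blin V W) : poly_map T.
Proof. by move=> k; exact: poly_upto_blin. Qed.

Lemma poly_mapD V W (p q : V -> W) :
  poly_map p -> poly_map q -> poly_map (fun x => p x + q x).
Proof. by move=> pp pq k; exact: poly_uptoD. Qed.

Lemma poly_mapZ V W a (p : V -> W) : poly_map p -> poly_map (fun x => a *: p x).
Proof. by move=> pp k; exact: poly_uptoZ. Qed.

Lemma poly_mapB V W (p q : V -> W) :
  poly_map p -> poly_map q -> poly_map (fun x => p x - q x).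
Proof.
move=> pp pq; under eq_fun do rewrite -(scaleN1r (q _)).
by apply: poly_mapD => //; exact: poly_mapZ.
Qed.

Lemma poly_map_bbil V P Q W (B : bbil P Q W) (p : V -> P) (q : V -> Q) :
  poly_map p -> poly_map q -> poly_map (fun x => B (p x) (q x)).
Proof. by move=> pp pq k; exact: poly_upto_bbil. Qed.

Lemma poly_map_comp V W P (p : W -> P) (q : V -> W) :
  poly_map p -> poly_map q -> poly_map (fun x => p (q x)).
Proof. by move=> pp pq k; exact: poly_upto_comp. Qed.

(** Established by closure under the operations that build the partial sums, with no appeal to a
    general theorem on mixed derivatives. *)
Definition sym_hess V W (p : V -> W) :=
  forall x u v, dblin (dblin p) x u v = dblin (dblin p) x v u.

Lemma sym_hess_blin V W (T : blin V W) : sym_hess T.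
Proof.
move=> x u v; rewrite (_ : dblin T = fun=> T); last first.
  by apply/funext => y; exact/hasD_dblin/hasD_blin.
by rewrite (hasD_dblin (hasD_cst _ _)).
Qed.

Lemma sym_hess_cst V W (a : W) : sym_hess (fun _ : V => a).
Proof.
move=> x u v; rewrite (_ : dblin (fun=> a) = fun=> 0); last first.
  by apply/funext => y; exact: (hasD_dblin (hasD_cst _ _)).
by rewrite (hasD_dblin (hasD_cst _ _)).
Qed.

Lemma sym_hessD V W (p q : V -> W) : poly_map p -> poly_map q ->
  sym_hess p -> sym_hess q -> sym_hess (fun x => p x + q x).
Proof.
move=> pp pq sp sq x u v.
have dp y := poly_map_differentiable y pp.
have dq y := poly_map_differentiable y pq.
rewrite (_ : dblin _ = fun x => dblin p x + dblin q x); last first.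
  by apply/funext => y; rewrite dblinD.
rewrite dblinD; try exact/poly_map_differentiable/poly_map_dblin.
by rewrite !blinDE sp sq.
Qed.

Lemma sym_hessZ V W a (p : V -> W) : poly_map p ->
  sym_hess p -> sym_hess (fun x => a *: p x).
Proof.
move=> pp sp x u v.
have dp y := poly_map_differentiable y pp.
rewrite (_ : dblin _ = fun x => a *: dblin p x); last first.
  by apply/funext => y; rewrite dblinZ.
rewrite dblinZ; try exact/poly_map_differentiable/poly_map_dblin.
by rewrite !blinZE sp.
Qed.

(** Differentiating twice gives one term with D^2 p, one with D^2 q, and two cross terms that are
    exchanged when [u] and [v] are. *)
Lemma sym_hess_bbil V P Q W (B : bbil P Q W) (p : V -> P) (q : V -> Q) :
  poly_map p -> poly_map q -> sym_hess p -> sym_hess q ->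
  sym_hess (fun x => B (p x) (q x)).
Proof.
move=> pp pq sp sq x u v.
have dp y := poly_map_differentiable y pp.
have dq y := poly_map_differentiable y pq.
have ddp y := poly_map_differentiable y (poly_map_dblin pp).
have ddq y := poly_map_differentiable y (poly_map_dblin pq).
rewrite (_ : dblin _ = fun x =>
  bbil_compl B V (dblin p x) (q x) + bbil_compr B V (p x) (dblin q x)); last first.
  by apply/funext => y; rewrite dblin_bbil.
rewrite dblinD; try exact: differentiable_bbil.
rewrite !dblin_bbil// !blinDE/= sp sq.
by rewrite -!addrA; congr (_ + _); rewrite addrCA.
Qed.

End PolynomialMaps.

(** * Cauchy estimates by averaging over roots of unity *)

Section CauchyEstimates.
Context {R : realType}.
Implicit Types V W : normedModType R[i].

(** [X^n - 1] splits over the algebraically closed field [R[i]] and is separable in characteristic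
    0; its n distinct roots include a primitive one. *)
Lemma exists_prim_root (n : nat) : (0 < n)%N ->
  exists z : R[i], n.-primitive_root z.
Proof.
move=> n0; have [r Dp] := closed_field_poly_normal ('X^n - 1 : {poly R[i]}).
have p1 : lead_coef ('X^n - 1 : {poly R[i]}) = 1.
  by have := monicXnsubC (1 : R[i]) n0; rewrite polyC1 qualifE/= => /eqP.
rewrite p1 scale1r in Dp.
have sz : (n <= size r)%N.
  by have := size_XnsubC (1 : R[i]) n0; rewrite polyC1 Dp size_prod_XsubC => -[->].
suff /hasP[z _ pz] : has n.-primitive_root r by exists z.
apply: has_prim_root => //.
  apply/allP => z; rewrite -root_prod_XsubC -Dp.
  by rewrite /root !hornerE subr_eq0 unity_rootE.
rewrite -separable_prod_XsubC -Dp separable_Xn_sub_1//.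
by rewrite pnatr_eq0 -lt0n.
Qed.

Lemma sum_powers_unity (z : R[i]) n : z ^+ n = 1 -> z != 1 ->
  \sum_(j < n) z ^+ j = 0.
Proof.
move=> zn z1; apply/eqP; have := subrX1 z n.
by rewrite zn subrr => /esym/eqP; rewrite mulf_eq0 subr_eq0 (negPf z1).
Qed.

Lemma norm_unity (z : R[i]) n : (0 < n)%N -> z ^+ n = 1 -> `|z| = 1.
Proof.
move=> n0 zn; apply/eqP; rewrite -(@pexpr_eq1 _ _ n)// -normrX zn.
by rewrite normr1.
Qed.

(* The coefficient is recovered by averaging over the [n]-th roots of unity. *)
Lemma cauchy_coef W (a : nat -> W) n (M : R[i]) (k : nat) :
  (forall t : R[i], `|t| = 1 -> `|\sum_(i < n) t ^+ i *: a i| <= M) ->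
  (k < n)%N -> `|a k| <= M.
Proof.
move=> aM kn; have n0 : (0 < n)%N by exact: leq_ltn_trans kn.
have [w pw] := exists_prim_root n0.
have wn := prim_expr_order pw.
have w0 : w != 0.
  by apply: contra_eq_neq wn => ->; rewrite expr0n gtn_eqF// eq_sym oner_eq0.
have nw : `|w| = 1 by exact: norm_unity wn.
have E : n%:R *: a k =
    \sum_(j < n) ((w ^+ j) ^- k) *: \sum_(i < n) (w ^+ j) ^+ i *: a i.
  under eq_bigr do rewrite scaler_sumr.
  rewrite exchange_big/= (bigD1 (Ordinal kn))//= [X in _ + X]big1 ?addr0.
    rewrite -[n in LHS]card_ord -sumr_const scaler_suml.
    apply: eq_bigr => j _; rewrite scalerA mulVf// expf_neq0// expf_neq0//.
  move=> i ik; under eq_bigr do rewrite scalerA.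
  rewrite -scaler_suml.
  (* For [i != k] this is a geometric sum whose ratio is an n-th root of unity; the ratio differs
     from 1 because [i] and [k] are both below the order n of [w], so the sum vanishes. *)
  rewrite (_ : \sum_(_ < _) _ = \sum_(j < n) (w ^+ i / w ^+ k) ^+ j).
    rewrite sum_powers_unity ?scale0r//.
      by rewrite expr_div_n -!exprM ![(_ * n)%N]mulnC !exprM wn !expr1n divr1.
    rewrite -(inj_eq (mulIf (expf_neq0 k w0))) mul1r divfK ?expf_neq0//.
    by rewrite (eq_prim_root_expr pw) !modn_small.
  by apply: eq_bigr => j _; rewrite expr_div_n -!exprM mulrC [(i * j)%N]mulnC
     [(k * j)%N]mulnC.
have n0' : 0 < n%:R :> R[i] by rewrite ltr0n.
suff : n%:R * `|a k| <= n%:R * M by rewrite ler_pM2l.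
rewrite -[n%:R in leLHS]gtr0_norm// -normrZ E.
rewrite (le_trans (ler_norm_sum _ _ _))//.
rewrite mulr_natl -[n in leRHS]card_ord -sumr_const ler_sum// => j _.
have nj : `|w ^+ j| = 1 by rewrite normrX nw expr1n.
by rewrite normrZ normfV normrX nj expr1n invr1 mul1r aM.
Qed.

Lemma cauchy_coef_disc W (a : nat -> W) n (M s : R[i]) (k : nat) : 0 < s ->
  (forall t : R[i], `|t| <= s -> `|\sum_(i < n) t ^+ i *: a i| <= M) ->
  (k < n)%N -> `|a k| <= M / s ^+ k.
Proof.
move=> s0 aM kn; rewrite ler_pdivlMr ?exprn_gt0// mulrC.
rewrite -{1}(gtr0_norm s0) -normrX -normrZ.
apply: (@cauchy_coef _ (fun i => s ^+ i *: a i) n) => // t t1.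
under eq_bigr do rewrite scalerA -exprMn.
by apply: aM; rewrite normrM t1 mul1r gtr0_norm.
Qed.

Lemma poly_curve_continuous W (c : R[i] -> W) : poly_curve c -> continuous (c : R[i]^o -> W).
Proof.
elim=> [n a|{}c d _ IHc _ IHd] t; last exact: (cvgD (IHc t) (IHd t)).
elim: n => [|n IH].
  rewrite (_ : (fun _ => _) = cst a); first exact: cst_continuous.
  by apply/funext => s; rewrite scale1r.
rewrite /continuous_at exprS -scalerA.
rewrite (_ : (fun _ => _) = fun s : R[i]^o => s *: (s ^+ n *: a)).
  by apply: cvgZ IH; exact: cvg_id.
by apply/funext => s; rewrite exprS scalerA.
Qed.

Lemma poly_curve_sum W n (a : nat -> W) :
  poly_curve (fun t : R[i] => \sum_(i < n) t ^+ i *: a i).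
Proof.
elim: n => [|n IH].
  by under eq_fun do rewrite big_ord0; exact: poly_curve_cst.
under eq_fun do rewrite big_ord_recr/=.
by apply: poly_curve_add => //; exact: poly_curve_mon.
Qed.

(** Away from [t = 0] the difference quotient along the line is the polynomial curve [d], which is
    continuous with value [a 1] at 0. The length [n.+2] ensures that this coefficient is present. *)
Lemma dblin_line_coef V W (p : V -> W) x h n (a : nat -> W) :
  differentiable p x ->
  (forall t, p (x + t *: h) = \sum_(i < n.+2) t ^+ i *: a i) ->
  dblin p x h = a 1%N.
Proof.
move=> dp pE; rewrite dblinE// -deriveE//; apply: cvg_lim => //=.
pose d (t : R[i]^o) := \sum_(i < n.+1) t ^+ i *: a i.+1.
have -> : a 1%N = d 0.
  rewrite /d big_ord_recl/= scale1r big1 ?addr0// => i _.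
  by rewrite expr0n/= scale0r.
have dc : d @ 0^' --> d 0.
  apply: cvg_trans; first exact: cvg_app (@nbhs_dnbhs _ 0).
  exact: (poly_curve_continuous (poly_curve_sum n.+1 (fun i => a i.+1))).
apply: cvg_trans dc; apply: near_eq_cvg; near=> t.
have t0 : t != 0 by near: t; exact: (@nbhs_dnbhs_neq R[i]^o 0).
have px : p x = a 0%N.
  have := pE 0; rewrite scale0r addr0 => ->.
  rewrite big_ord_recl/= scale1r big1 ?addr0// => i _.
  by rewrite expr0n/= scale0r.
have -> : p (t *: h + x) - p x = t *: d t.
  rewrite [_ + x]addrC pE px big_ord_recl/= scale1r addrAC subrr add0r.
  by rewrite scaler_sumr; apply: eq_bigr => i _; rewrite scalerA -exprS.
by rewrite scalerA mulVf// scale1r.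
Unshelve. all: by end_near. Qed.

Lemma sum_geometric_le (q : R[i]) n : 0 <= q -> q <= 2^-1 ->
  \sum_(i < n) q ^+ i <= 2.
Proof.
move=> q0 q2; have q1 : 0 < 1 - q.
  by rewrite subr_gt0 (le_lt_trans q2)// invf_lt1 ?ltr1n.
have E : (1 - q) * (\sum_(i < n) q ^+ i) = 1 - q ^+ n.
  by rewrite -[in LHS]opprB mulNr -subrX1 opprB.
suff : (1 - q) * (\sum_(i < n) q ^+ i) <= (1 - q) * 2 by rewrite ler_pM2l.
rewrite E.
apply: (@le_trans _ _ 1); first by rewrite gerBl exprn_ge0.
rewrite mulrBl mul1r lerBrDr -lerBrDl.
rewrite (_ : 2 - 1 = 2^-1 * 2); first by rewrite ler_wpM2r.
by rewrite mulVf ?pnatr_eq0//; ring.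
Qed.

End CauchyEstimates.

(** * Completeness of operator spaces and the Weierstrass theorem *)

Section UniformLimits.
Context {R : realType}.
Implicit Types V W : normedModType R[i].

Lemma addrKl (U : zmodType) (a b : U) : a + b - a = b.
Proof. by rewrite addrAC subrr add0r. Qed.

Section poly_map_estimates.
Variables (V W : normedModType R[i]) (p : V -> W) (M r : R[i]) (x : V).
Hypotheses (pp : poly_map p) (r0 : 0 < r).
Hypothesis pM : forall y, `|y| < r -> `|p y| <= M.
Hypothesis xr : `|x| < r / 2.

Let M0 : 0 <= M.
Proof. by rewrite (le_trans _ (pM (_ : `|0| < r)))// normr0. Qed.

(** For [|t| <= 1 / q] the point [x + t *: h] stays in the ball of radius [r], since [|x| < r / 2]
    and [|t *: h| <= r / 2]. Cauchy's estimate on that disc gives the factor [q ^+ k]. *)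
Lemma poly_map_line_coef (q : R[i]) h : 0 < q -> `|h| <= q * (r / 2) ->
  exists n (a : nat -> W), [/\ p (x + h) = \sum_(i < n.+2) a i, a 0 = p x,
    a 1 = dblin p x h & forall k, (k < n.+2)%N -> `|a k| <= M * q ^+ k].
Proof.
move=> q0 hq.
have [n [a pa]] := poly_curve_coef (poly_map_curve pp (poly_curve_line x h)).
have {}pa := pa n.+2 (leq_trans (leqnSn n) (leqnSn _)).
exists n, a; split.
- rewrite -{1}(scale1r h) pa; apply: eq_bigr => i _.
  by rewrite expr1n scale1r.
- have := pa 0; rewrite scale0r addr0 big_ord_recl/= scale1r big1 ?addr0// => i _.
  by rewrite expr0n/= scale0r.
- by apply/esym/dblin_line_coef => //; exact: poly_map_differentiable.
move=> k kn; rewrite -[q]invrK exprVn.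
apply: (cauchy_coef_disc _ _ kn); rewrite ?invr_gt0// => t tq.
rewrite -pa pM// (le_lt_trans (ler_normD _ _))// [ltRHS]splitr ltr_leD//.
rewrite normrZ (le_trans _ (_ : q^-1 * (q * (r / 2)) <= _))//; last by rewrite mulKf// gt_eqF.
by rewrite ler_pM.
Qed.

Lemma dblin_poly_map_le : `|dblin p x| <= M * (2 / r).
Proof.
apply: blin_norm_le => h h1.
(* With [q = 2 / r] the condition on [h] becomes [|h| <= 1], the range that defines the operator
   norm. *)
have [||n [a [_ _ <- aM]]] := @poly_map_line_coef (2 / r) h.
- by rewrite divr_gt0.
- by rewrite mulf_div [r * 2]mulrC divff// mulf_neq0// ?pnatr_eq0// gt_eqF.
by have := aM 1%N isT; rewrite expr1.
Qed.

Lemma poly_map_taylor1_le (q : R[i]) h : 0 < q -> q <= 2^-1 ->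
  `|h| <= q * (r / 2) ->
  `|p (x + h) - p x - dblin p x h| <= 2 * M * q ^+ 2.
Proof.
move=> q0 q2 hq; have q0' := ltW q0; have [n [a [-> <- <- aM]]] := poly_map_line_coef q0 hq.
rewrite !big_ord_recl/= !addrKl.
rewrite (le_trans (ler_norm_sum _ _ _))//.
rewrite (@le_trans _ _ (\sum_(i < n) M * q ^+ 2 * q ^+ i))//.
  by apply: ler_sum => i _; rewrite -mulrA -exprD; apply: aM; rewrite /= !ltnS.
rewrite -mulr_sumr -[leRHS]mulrA [leLHS]mulrC ler_wpM2r// ?mulr_ge0 ?exprn_ge0//.
exact: sum_geometric_le.
Qed.

Lemma poly_map_lipschitz_le (q : R[i]) h : 0 < q -> q <= 2^-1 ->
  `|h| <= q * (r / 2) -> `|p (x + h) - p x| <= 2 * M * q.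
Proof.
move=> q0 q2 hq; have q0' := ltW q0; have [n [a [-> <- _ aM]]] := poly_map_line_coef q0 hq.
rewrite big_ord_recl/= addrKl.
rewrite (le_trans (ler_norm_sum _ _ _))//.
rewrite (@le_trans _ _ (\sum_(i < n.+1) M * q * q ^+ i))//.
  by apply: ler_sum => i _; rewrite -mulrA -exprS; apply: aM; exact: (ltn_ord i).
rewrite -mulr_sumr -[leRHS]mulrA [leLHS]mulrC ler_wpM2r// ?mulr_ge0//.
exact: sum_geometric_le.
Qed.

End poly_map_estimates.

Definition cauchy_sequence W (u : nat -> W) := forall e : R[i], 0 < e ->
  exists N, forall m n, (N <= m)%N -> (N <= n)%N -> `|u m - u n| <= e.

(** Completeness is kept as a property, to be transferred to the iterated operator spaces in which
    the higher derivatives live. *)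
Definition seq_complete W := forall u : nat -> W, cauchy_sequence u ->
  exists l : W, u n @[n --> \oo] --> l.

Lemma limit_norm_le W (u : nat -> W) (l : W) (M : R[i]) :
  u n @[n --> \oo] --> l -> (\forall n \near \oo, `|u n| <= M) -> `|l| <= M.
Proof.
move=> ul uM; apply/ler_addgt0Pr => e e0.
near \oo => n.
rewrite -(subrK (u n) l) (le_trans (ler_normD _ _))// addrC lerD//.
  by near: n.
by near: n; move/cvgrPdist_le : ul; exact.
Unshelve. all: by end_near. Qed.

Lemma seq_complete_complete (X : completeNormedModType R[i]) : seq_complete X.
Proof.
move=> u uC.
suff : cvg (u n @[n --> \oo]) by move=> ul; exists (lim (u @ \oo)).
apply/cauchy_cvgP/cauchy_ballP => e e0.
have [|N uN] := uC (e / 2); first by rewrite divr_gt0.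
exists (u @` [set n | (N <= n)%N], u @` [set n | (N <= n)%N]) => /=.
  by split; exists N => // n /= Nn; exists n.
move=> [_ _] [[m /= Nm <-] [n /= Nn <-]] /=.
rewrite -ball_normE/=; apply: le_lt_trans (uN _ _ Nm Nn) _.
by rewrite ltr_pdivrMr// ltr_pMr// ltr1n.
Qed.

Lemma cvg_blin_app V W (u : nat -> blin V W) (T : blin V W) x :
  u n @[n --> \oo] --> T -> u n x @[n --> \oo] --> T x.
Proof.
move=> uT; apply/cvgrPdist_le => e e0.
near=> n; rewrite -[_ - _]/((T - u n) x) (le_trans (blin_norm _ _))//.
rewrite (@le_trans _ _ (e / (`|x| + 1) * `|x|))//.
  rewrite ler_wpM2r//; near: n; move/cvgrPdist_le : uT; apply.
  by rewrite divr_gt0// ltr_wpDl.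
by rewrite mulrAC ler_pdivrMr ?ltr_wpDl// ler_wpM2l ?lerDl// ltW.
Unshelve. all: by end_near. Qed.

Lemma cauchy_sequence_app V W (u : nat -> blin V W) x :
  cauchy_sequence u -> cauchy_sequence (fun n => u n x).
Proof.
move=> uC e e0; have [|N uN] := uC (e / (`|x| + 1)).
  by rewrite divr_gt0// ltr_wpDl.
exists N => m n Nm Nn; rewrite -[_ - _]/((u m - u n) x).
rewrite (le_trans (blin_norm _ _))//.
rewrite (le_trans (ler_wpM2r _ (uN _ _ Nm Nn)))//.
by rewrite mulrAC ler_pdivrMr ?ltr_wpDl// ler_wpM2l ?lerDl// ltW.
Qed.

Lemma seq_complete_blin V W : seq_complete W -> seq_complete (blin V W).
Proof.
move=> cW u uC.
have /choice[L uL] x : exists l : W, u n x @[n --> \oo] --> l.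
  exact/cW/cauchy_sequence_app.
have lL : linear L.
  move=> a x y; have := uL (a *: x + y).
  rewrite (_ : (fun n => u n _) = fun n => a *: u n x + u n y).
    by move/cvg_unique; apply => //; apply: cvgD => //; exact: cvgZl_tmp.
  by apply/funext => n; rewrite linearP.
have close (e : R[i]) : 0 < e -> exists N, forall n, (N <= n)%N ->
    forall x, `|L x - u n x| <= e * `|x|.
  move=> e0; have [N uN] := uC e e0; exists N => n Nn x.
  apply: (@limit_norm_le _ (fun m => u m x - u n x)).
    by apply: cvgB => //; exact: cvg_cst.
  exists N => // m /= Nm; rewrite -[_ - _]/((u m - u n) x).
  by rewrite (le_trans (blin_norm _ _))// ler_wpM2r// uN.
have bL : exists C : R[i], forall x, `|L x| <= C * `|x|.
  have [N LN] := close 1 ltr01; exists (1 + `|u N|) => x.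
  rewrite -(subrK (u N x) (L x)) (le_trans (ler_normD _ _))// mulrDl lerD//.
    exact: LN.
  exact: blin_norm.
exists (mkblin lL bL); apply/cvgrPdist_le => e e0.
have [N LN] := close e e0; exists N => // n /= Nn.
apply: blin_norm_le => x x1; rewrite blinDE blinNE/= (le_trans (LN _ Nn x))//.
by rewrite ler_piMr// ltW.
Qed.

(** The bound uniform in [n] lets one Cauchy estimate control the Taylor remainders of all the
    approximants at once. *)
Record poly_approx V W (Fn : nat -> V -> W) (F : V -> W) (r : R[i]) : Prop := {
  approx_poly : forall n, poly_map (Fn n) ;
  approx_bounded : exists M : R[i], forall n x, `|x| < r -> `|Fn n x| <= M ;
  approx_unif : forall e : R[i], 0 < e ->
    \forall n \near \oo, forall x, `|x| < r -> `|F x - Fn n x| <= e }.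

Lemma approx_cvg V W (Fn : nat -> V -> W) F r x : poly_approx Fn F r ->
  `|x| < r -> Fn n x @[n --> \oo] --> F x.
Proof.
move=> [_ _ FnF] xr; apply/cvgrPdist_le => e e0.
by have := FnF e e0; apply: filterS => n; exact.
Qed.

Lemma approx_cauchy V W (Fn : nat -> V -> W) F r (e : R[i]) :
  poly_approx Fn F r -> 0 < e -> exists N, forall m n, (N <= m)%N -> (N <= n)%N ->
    forall x, `|x| < r -> `|Fn m x - Fn n x| <= e.
Proof.
move=> [_ _ FnF] e0; have [|N _ FN] := FnF (e / 2); first by rewrite divr_gt0.
exists N => m n Nm Nn x xr.
rewrite -(subrKA (F x)) (le_trans (ler_normD _ _))// [leRHS]splitr lerD//.
  by rewrite distrC FN.
exact: FN.
Qed.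

(* Weierstrass: Cauchy estimates turn uniform convergence of bounded polynomial
   maps into uniform convergence of their derivatives on a smaller ball. *)
Theorem approx_dblin V W (Fn : nat -> V -> W) F r :
  seq_complete W -> 0 < r -> poly_approx Fn F r ->
  (forall x, `|x| < r / 2 -> differentiable F x) /\
  poly_approx (fun n => dblin (Fn n)) (dblin F) (r / 2).
Proof.
move=> cW r0 FnF; have [M FM] := approx_bounded FnF.
have pF := approx_poly FnF.
have r2 : 0 < 2 / r by rewrite divr_gt0.
(* Cauchy's estimate is applied to the differences [Fn m - Fn n]; it costs a factor [2 / r], by
   which [e] is divided beforehand. *)
have DC (e : R[i]) : 0 < e -> exists N, forall m n, (N <= m)%N -> (N <= n)%N ->
    forall x, `|x| < r / 2 -> `|dblin (Fn m) x - dblin (Fn n) x| <= e.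
  move=> e0; have [|N FN] := approx_cauchy FnF (_ : 0 < e / (2 / r)).
    by rewrite divr_gt0.
  exists N => m n Nm Nn x xr.
  rewrite (_ : _ - _ = dblin (fun y => Fn m y - Fn n y) x).
    rewrite -[leRHS](divfK (lt0r_neq0 r2)).
    by apply: dblin_poly_map_le xr => // [|y yr]; [exact: poly_mapB|exact: FN].
  rewrite (_ : (fun y => _) = fun y => Fn m y + (-1) *: Fn n y); last first.
    by apply/funext => y; rewrite scaleN1r.
  have dm := poly_map_differentiable x (pF m).
  have dn := poly_map_differentiable x (pF n).
  by rewrite dblinD ?dblinZ ?scaleN1r//; exact: (differentiableZ _ dn).
have /choice[G GF] x : exists l : blin V W, `|x| < r / 2 ->
    dblin (Fn n) x @[n --> \oo] --> l.
  have [xr|] := boolP (`|x| < r / 2); last by exists 0.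
  have [|l ul] := @seq_complete_blin V W cW (fun n => dblin (Fn n) x).
    by move=> e /DC[N DN]; exists N => m n Nm Nn; exact: DN.
  by exists l.
have FD x : `|x| < r / 2 -> hasD F x (G x).
  move=> xr e e0.
  have M0 : 0 <= M by rewrite (le_trans _ (FM 0%N 0 _))// normr0.
  pose K := 2 * M * (2 / r) ^+ 2.
  have K0 : 0 <= K by apply: mulr_ge0; [exact: mulr_ge0|exact/exprn_ge0/ltW].
  near=> h.
  have [->|h0] := eqVneq h 0.
    by rewrite addr0 linear0 !subrr !normr0 mulr0.
  (* This keeps [x + h] in the ball of radius [r] and makes the ratio [2 / r * |h|] of the Taylor
     estimate at most 1/2. *)
  have hr : `|h| < r / 4 by near: h; apply: nbhs0_lt; rewrite divr_gt0.
  have hK : `|h| <= e / (K + 1).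
    by near: h; apply: nbhs0_le; rewrite divr_gt0// ltr_wpDl.
  have r4 : r / 2 = r / 4 + r / 4 by field.
  (* The quadratic remainder bound has the same [K] for every [n], so it survives the limit; hence
     [G x] is the derivative of [F] at [x]. *)
  apply: (@le_trans _ _ (K * `|h| ^+ 2)).
    apply: (@limit_norm_le _ (fun n => Fn n (x + h) - Fn n x - dblin (Fn n) x h)).
      apply: cvgB; last exact/cvg_blin_app/GF.
      apply: cvgB; apply: approx_cvg FnF _.
        rewrite (le_lt_trans (ler_normD _ _))// [ltRHS]splitr ltrD//.
        by rewrite (lt_le_trans hr)// r4 lerDl divr_ge0// ltW.
      by rewrite (lt_le_trans xr)// ler_piMr ?invf_le1 ?ler1n// ltW.
    apply: nearW => n; rewrite -mulrA -exprMn.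
    apply: (poly_map_taylor1_le (pF n) r0 (FM n) xr).
    - by rewrite mulr_gt0// normr_gt0.
    - rewrite mulrC -ler_pdivlMr// (le_trans (ltW hr))//.
      rewrite (_ : r / 4 = 2^-1 / (2 / r))//; field; exact: lt0r_neq0.
    - rewrite (_ : 2 / r * `|h| * (r / 2) = `|h|)//; field; exact: lt0r_neq0.
  rewrite expr2 mulrA ler_wpM2r// (le_trans (ler_wpM2l K0 hK))//.
  by rewrite mulrA ler_pdivrMr ?ltr_wpDl// [leLHS]mulrC ler_wpM2l ?lerDl// ltW.
split=> [x xr|]; first exact: hasD_differentiable (FD x xr).
split=> [n||e e0]; first exact: poly_map_dblin.
  exists (M * (2 / r)) => n x xr.
  by apply: dblin_poly_map_le xr => //; exact: FM.
have [N DN] := DC e e0; exists N => // n /= Nn x xr.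
rewrite (hasD_dblin (FD x xr)).
apply: (@limit_norm_le _ (fun m => dblin (Fn m) x - dblin (Fn n) x)).
  by apply: cvgB; [exact: GF|exact: cvg_cst].
by exists N => // m /= Nm; exact: DN.
Unshelve. all: by end_near. Qed.

End UniformLimits.

(** * Geometric bounds and uniform convergence of the homogeneous series *)

Section TaylorSeries.
Context {R : realType}.

Section diagonal.
Variable X : normedModType R[i].

Definition mlin_diag k (T : mlin X k) (x : X) : X :=
  mlin_app T [tuple of nseq k x].

Lemma mlin_diagS k (T : mlin X k.+1) x :
  mlin_diag T x = mlin_diag ((T : blin X (mlin X k)) x) x.
Proof.
apply: (congr2 (fun y (v : k.-tuple X) => mlin_app ((T : blin X (mlin X k)) y) v)).
  by [].
exact: val_inj.
Qed.

Lemma mlin_appZ k a (T : mlin X k) v : mlin_app (a *: T) v = a *: mlin_app T v.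
Proof. by elim: k T v => [//|k IH] T v; exact: IH. Qed.

Lemma mlin_diag_scale k (T : mlin X k) a x :
  mlin_diag T (a *: x) = a ^+ k *: mlin_diag T x.
Proof.
elim: k T => [|k IH] T; first by rewrite scale1r.
rewrite !mlin_diagS IH linearZ exprSr -scalerA; congr (_ *: _).
exact: mlin_appZ.
Qed.

(** The operator may depend on [x] so that the induction can absorb one argument at a time: [T x x]
    is again a polynomial map, with values in operators of one degree less. *)
Lemma mlin_diag_poly k (T : X -> mlin X k) : poly_map T -> sym_hess T ->
  poly_map (fun x => mlin_diag (T x) x) /\ sym_hess (fun x => mlin_diag (T x) x).
Proof.
elim: k T => [//|k IH] T pT sT.
rewrite (_ : (fun x => _) = fun x => mlin_diag (blin_eval X (mlin X k) (T x) (blin_id X x)) x).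
  apply: IH; first by apply: poly_map_bbil => //; exact: poly_map_blin.
  by apply: sym_hess_bbil => //; [exact: poly_map_blin|exact: sym_hess_blin].
by apply/funext => x; rewrite mlin_diagS.
Qed.

Variable f : X -> X.

(* The homogeneous terms of the normalized series: [0], [x], then [P_k]. *)
Definition hom_term (k : nat) (x : X) : X :=
  match k with 0 => 0 | 1 => x | _ => taylor_poly f k x end.

Lemma hom_term_scale k a x : hom_term k (a *: x) = a ^+ k *: hom_term k x.
Proof.
case: k => [|[|k]]; first by rewrite /= scaler0.
  by [].
rewrite [in LHS]/hom_term /taylor_poly [nderiv _ _ _]mlin_diag_scale.
by rewrite scalerA mulrC -scalerA.
Qed.

Lemma hom_term_poly k : poly_map (hom_term k) /\ sym_hess (hom_term k).
Proof.
case: k => [|[|k]].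
- by split; [exact: poly_map_cst|exact: sym_hess_cst].
- by split; [exact: (poly_map_blin (blin_id X))|exact: (sym_hess_blin (blin_id X))].
have [pD sD] := @mlin_diag_poly k.+2 (fun=> frechet k.+2 f 0)
  (@poly_map_cst _ _ _ _) (@sym_hess_cst _ _ _ _).
by split; [exact: poly_mapZ|exact: sym_hessZ].
Qed.

(** The shift by 2 makes [hom_sum 0] the identity, so the distance to the identity is a special case
    of a tail estimate. *)
Definition hom_sum n (x : X) := \sum_(i < n.+2) hom_term i x.

Lemma hom_sumE n x :
  hom_sum n x = x + \sum_(2 <= k < n.+2) taylor_poly f k x.
Proof.
rewrite /hom_sum -(big_mkord xpredT (hom_term^~ x)) big_ltn// big_ltn// add0r.
congr (_ + _); rewrite big_nat [RHS]big_nat.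
by apply: eq_bigr => -[|[|k]].
Qed.

Lemma hom_sum_poly n : poly_map (hom_sum n) /\ sym_hess (hom_sum n).
Proof.
rewrite /hom_sum; elim: n.+2 => [|m [pm sm]].
  under eq_fun do rewrite big_ord0.
  by split; [exact: poly_map_cst|exact: sym_hess_cst].
have [pt st] := hom_term_poly m.
rewrite (_ : (fun x => _) = fun x => \sum_(i < m) hom_term i x + hom_term m x).
  by split; [exact: poly_mapD|exact: sym_hessD].
by apply/funext => x; rewrite big_ord_recr.
Qed.

Lemma sum_tail_le (u : nat -> X) (M q : R[i]) n m : 0 <= M -> 0 <= q ->
  q <= 2^-1 -> (forall i, (n <= i < m)%N -> `|u i| <= M * q ^+ i) -> (n <= m)%N ->
  `|\sum_(i < m) u i - \sum_(i < n) u i| <= 2 * M * q ^+ n.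
Proof.
move=> M0 q0 q2 uM nm.
rewrite -(big_mkord xpredT u) -(big_mkord xpredT u) (big_cat_nat _ (n := n))//=.
rewrite addrKl -{1}[n]add0n big_addn big_mkord (le_trans (ler_norm_sum _ _ _))//.
rewrite (@le_trans _ _ (\sum_(i < m - n) M * q ^+ n * q ^+ i))//.
  apply: ler_sum => i _; rewrite -mulrA -exprD addnC uM// leq_addr/=.
  by rewrite -ltn_subRL.
rewrite -mulr_sumr -[leRHS]mulrA [leLHS]mulrC ler_wpM2r ?mulr_ge0 ?exprn_ge0//.
exact: sum_geometric_le.
Qed.

(** Pointwise convergence is not uniform on the circle [t *: x], but homogeneity makes the norm of
    each term constant there. Convergence at [2 *: x] then brings one partial sum within 1 of [f] on
    the whole circle, and averaging bounds each of its terms. *)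
Lemma hom_term_bound :
  holomorphic_near0 f -> normalized_expansion f ->
  exists c M : R[i], [/\ 0 < c, 0 <= M &
    forall k x, `|hom_term k x| <= M * (c * `|x|) ^+ k].
Proof.
move=> hf hexp.
have fc : {for 0, continuous f}.
  by apply: differentiable_continuous; exact: nbhs_singleton hf.
have fM : \forall x \near 0, `|f x| <= `|f 0| + 1.
  move/cvgrPdist_le : fc => /(_ 1 ltr01); apply: filterS => x fx.
  by rewrite -[f x](subKr (f 0)) (le_trans (ler_normB _ _))// lerD.
have /nbhs_norm0P[d /= d0 fd] : \forall x \near 0,
    (fun n => x + \sum_(2 <= k < n) taylor_poly f k x) @ \oo --> f x /\
    `|f x| <= `|f 0| + 1 by near=> x; split; near: x.
have {fd fM}[fcvg fM] : (forall x, `|x| < d -> hom_sum n x @[n --> \oo] --> f x) /\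
    (forall x, `|x| < d -> `|f x| <= `|f 0| + 1).
  split=> x /fd[fx //] _; rewrite -(cvg_shiftn 2) in fx.
  rewrite (_ : (fun n => _) = fun n =>
    x + \sum_(2 <= k < n + 2) taylor_poly f k x)//.
  by apply/funext => n; rewrite hom_sumE addn2.
(* [|f 0| + 1] bounds [f] near 0; the last 1 pays for replacing [f] by a partial sum. *)
pose M := `|f 0| + 1 + 1.
have bnd k x : `|x| < d / 2 -> `|hom_term k x| <= M.
  move=> xd.
  have x2d : `|2 *: x| < d.
    by rewrite normrZ normr_nat -ltr_pdivlMl// mulrC.
  (* Consecutive partial sums have the same limit, so the terms at [2 *: x] tend to 0. By
     homogeneity the term of large degree k at [t *: x], with [|t| = 1], is then at most
     [2^-1 ^+ k]. *)
  have [N _ PN] : \forall n \near \oo, `|hom_term n.+2 (2 *: x)| <= 1.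
    have fx := fcvg _ x2d; have := fx; rewrite -(cvg_shiftn 1) => fx1.
    have : (fun n => hom_sum (n + 1) (2 *: x) - hom_sum n (2 *: x)) @ \oo -->
        f (2 *: x) - f (2 *: x) by exact: cvgB.
    move=> /cvgrPdist_le/(_ 1 ltr01); apply: filterS => n.
    by rewrite subrr sub0r normrN addn1 {1}/hom_sum big_ord_recr addrKl.
  pose n := maxn N k.
  have kn : (k < n.+2)%N by rewrite ltnS (leq_trans (leq_maxr N k))// leqnSn.
  apply: (@cauchy_coef _ _ (fun i => hom_term i x) n.+2) => // t t1.
  under eq_bigr do rewrite -hom_term_scale.
  rewrite -[\sum_(_ < _) _]/(hom_sum n (t *: x)).
  have txd : `|t *: x| < d.
    rewrite normrZ t1 mul1r (lt_le_trans xd)// ler_piMr ?invf_le1 ?ler1n// ltW//.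
  rewrite -(subrK (f (t *: x)) (hom_sum n _)) (le_trans (ler_normD _ _))//.
  rewrite addrC lerD ?fM//.
  rewrite distrC.
  apply: (@limit_norm_le _ _ (fun m => hom_sum m (t *: x) - hom_sum n (t *: x))).
    by apply: cvgB; [exact: fcvg|exact: cvg_cst].
  exists n => // m /= nm.
  have h2 : 0 <= 2^-1 :> R[i] by rewrite invr_ge0.
  have tail := @sum_tail_le (hom_term^~ (t *: x)) 1 2^-1 n.+2 m.+2.
  apply: le_trans (tail _ _ _ _ _) _ => //.
    move=> i /andP[ni _]; rewrite hom_term_scale normrZ normrX t1 expr1n !mul1r.
    case: i ni => [//|[//|i]]; rewrite !ltnS => ni.
    have := PN i (leq_trans (leq_maxl N k) ni).
    rewrite hom_term_scale normrZ normrX normr_nat exprVn.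
    by rewrite -ler_pdivlMl ?exprn_gt0// mulr1.
  rewrite mulr1 exprS mulrA divff ?pnatr_eq0// mul1r.
  by rewrite exprn_ile1// invf_le1 ?ler1n.
have M0 : 0 <= M by rewrite !addr_ge0.
(* [bnd] requires norm below [d / 2]. It is used at the multiple of [x] of norm [d / 3], and scaling
   back yields the constant [3 / d]. *)
have d3 : 0 < d / 3 by rewrite divr_gt0.
exists (3 / d), M; split=> [||k x]; rewrite ?divr_gt0//.
have [->|x0] := eqVneq x 0.
  have -> : hom_term k 0 = 0.
    case: k => [//|k].
    by rewrite -[X in hom_term _ X](scale0r 0) hom_term_scale expr0n scale0r.
  by rewrite normr0 mulr_ge0// exprn_ge0// mulr_ge0// divr_ge0// ltW.
have nx : 0 < `|x| by rewrite normr_gt0.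
have := bnd k ((d / 3) *: (`|x|^-1 *: x)).
rewrite scalerA hom_term_scale !normrZ.
have -> : `|d / 3 / `|x| | * `|x| = d / 3.
  by rewrite gtr0_norm ?divr_gt0// divfK// gt_eqF.
case/(_ _)/wrap.
  by rewrite ltr_pM2l// ltf_pV2 ?posrE// ltr_nat.
rewrite normrX gtr0_norm ?divr_gt0// -ler_pdivlMl ?exprn_gt0 ?divr_gt0//.
move=> /le_trans; apply; rewrite mulrC -exprVn.
rewrite (_ : (d / 3 / `|x|)^-1 = 3 / d * `|x|)//.
by rewrite !invf_div mulrC.
Unshelve. all: by end_near. Qed.

End diagonal.

Lemma geometric_near_le (C e : R[i]) : 0 <= C -> 0 < e ->
  \forall n \near \oo, C * 2^-1 ^+ n <= e.
Proof.
move=> C0 e0; have h1 : `|2^-1 : R| < 1.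
  by rewrite ger0_norm ?invr_ge0// invf_lt1 ?ltr1n.
have ce : 0 < complex.Re e by rewrite -ltcR RRe_real// gtr0_real.
have /cvgrPdist_le/(_ _ ce) := cvg_geometric (complex.Re C) h1.
apply: filterS => n; rewrite sub0r normrN => /(le_trans (ler_norm _)) Cn.
have E : C * 2^-1 ^+ n = (complex.Re C * 2^-1 ^+ n)%:C%C.
  rewrite -{1}(RRe_real (ger0_real C0)) rmorphM rmorphXn fmorphV rmorph_nat.
  by [].
by rewrite E -(RRe_real (gtr0_real e0)) lecR.
Qed.

(** The two explicit estimates prepare the inversion: quadratic distance to the identity makes the
    iteration contract, and the geometric rate makes it harmless to change the map at each step. *)
Lemma hom_sum_approx (X : completeNormedModType R[i]) (f : X -> X) :
  holomorphic_near0 f -> normalized_expansion f ->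
  exists r C : R[i], [/\ 0 < r, 0 <= C, poly_approx (hom_sum f) f r,
    forall n x, `|x| < r -> `|hom_sum f n x - x| <= C * `|x| ^+ 2 &
    forall n m x, `|x| < r -> (n <= m)%N ->
      `|hom_sum f m x - hom_sum f n x| <= C * 2^-1 ^+ n].
Proof.
move=> hf hexp; have [c [M [c0 M0 fM]]] := hom_term_bound hf hexp.
have c0' := ltW c0.
have /nbhs_norm0P[d /= d0 fd] := hexp.
have [r [r0 rd rc]] : exists r : R[i], [/\ 0 < r, r <= d & c * r <= 2^-1].
  have p0 : 0 < (2 * c)^-1 by rewrite invr_gt0 mulr_gt0.
  have [dc|cd] := real_leP (gtr0_real d0) (gtr0_real p0).
    exists d; split=> //; rewrite (le_trans (ler_wpM2l c0' dc))//.
    by rewrite invfM mulrCA mulfV ?mulr1// gt_eqF.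
  exists (2 * c)^-1; split=> //; first exact: ltW.
  by rewrite invfM mulrCA mulfV ?mulr1// gt_eqF.
have cx x : `|x| < r -> c * `|x| <= 2^-1.
  by move=> xr; rewrite (le_trans _ rc)// ler_wpM2l// ltW.
have tail n m x : `|x| < r -> (n <= m)%N ->
    `|hom_sum f m x - hom_sum f n x| <= 2 * M * (c * `|x|) ^+ n.+2.
  move=> xr nm; apply: (@sum_tail_le _ (hom_term f ^~ x)) => //; first exact: mulr_ge0.
  exact: cx.
(* One constant for both estimates: the first summand serves the geometric rate, the second the
   quadratic bound. *)
pose C := 2 * M + 2 * M * c ^+ 2.
have C1 : 2 * M <= C by rewrite lerDl !mulr_ge0// exprn_ge0.
have C2 : 2 * M * c ^+ 2 <= C by rewrite lerDr mulr_ge0.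
have C0 : 0 <= C by rewrite (le_trans _ C1)// mulr_ge0.
have rate n m x : `|x| < r -> (n <= m)%N ->
    `|hom_sum f m x - hom_sum f n x| <= C * 2^-1 ^+ n.
  move=> xr nm; apply: le_trans (tail _ _ _ xr nm) _.
  have h2 : 0 <= 2^-1 :> R[i] by rewrite invr_ge0.
  apply: ler_pM => //; [exact: mulr_ge0|exact/exprn_ge0/mulr_ge0|].
  apply: (@le_trans _ _ (2^-1 ^+ n.+2)).
    by rewrite lerXn2r ?nnegrE ?mulr_ge0// cx.
  by apply: ler_wiXn2l; rewrite ?invf_le1 ?ler1n// leqW.
have id2 n x : `|x| < r -> `|hom_sum f n x - x| <= C * `|x| ^+ 2.
  move=> xr; rewrite (_ : _ - x = hom_sum f n x - hom_sum f 0 x).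
    apply: le_trans (tail _ _ _ xr (leq0n n)) _.
    by rewrite exprMn mulrA; apply: ler_wpM2r => //; exact: exprn_ge0.
  by rewrite (hom_sumE f 0) big_geq// addr0.
exists r, C; split=> //; split=> [n||e e0].
- by have [] := hom_sum_poly f n.
- exists (r + C * r ^+ 2) => n x xr.
  rewrite -(subrK x (hom_sum f n x)) (le_trans (ler_normD _ _))// addrC lerD//.
    exact: ltW.
  rewrite (le_trans (id2 _ _ xr))// ler_wpM2l// lerXn2r ?nnegrE//; exact: ltW.
have := geometric_near_le C0 e0; apply: filterS => n ne x xr.
apply: (@limit_norm_le _ _ (fun m => hom_sum f m x - hom_sum f n x)).
  apply: cvgB; last exact: cvg_cst.
  have fx := fd x (lt_le_trans xr rd); rewrite -(cvg_shiftn 2) in fx.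
  rewrite (_ : (fun n => _) = fun n =>
    x + \sum_(2 <= k < n + 2) taylor_poly f k x)//.
  by apply/funext => m; rewrite hom_sumE addn2.
by exists n => // m /= nm; exact: le_trans (rate _ _ _ xr nm) ne.
Qed.

End TaylorSeries.

(** * The local inverse as a uniform limit of polynomial maps *)

Section LocalInverse.
Context {R : realType} (X : completeNormedModType R[i]).

(** To be read with [F = f h], [S = S_n h], [G] the n-th iterate and [p = phi_n G]: then [y - p] is
    the next iterate, and each bracket on the right is small. *)
Lemma residual_split (F S h p G y : X) :
  F - y = (F - S) + ((S - h) - p) + ((h - G) - ((y - p) - G)).
Proof.
rewrite [- (_ - G)]opprB subrKA -[S - h - p]addrA subrKA -addrA; congr (_ + _).
by rewrite opprB -opprD [h + (_ - _)]addrA addKr.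
Qed.

(** Iterating with [f] itself would leave the class of polynomial maps, so step n uses the n-th
    partial sum; the error from changing the map is summable. The limit is a right inverse of [f],
    and the left inverse [g] must coincide with it near 0. *)
Lemma local_inverse_approx (f g : X -> X) :
  holomorphic_near0 f -> normalized_expansion f -> local_inverse f g ->
  exists (Gn : nat -> X -> X) (s : R[i]), 0 < s /\ poly_approx Gn g s.
Proof.
move=> hf hexp [U [V [[oU U0] _ _ fgK]]].
have [r [C [r0 C0 Sf Sid Srate]]] := hom_sum_approx hf hexp.
pose S := hom_sum f.
have pS n : poly_map (S n) by have [] := hom_sum_poly f n.
(* On the ball of radius [d] each [phi n] is bounded by [C * d ^+ 2], and Cauchy's estimate turns
   this into the Lipschitz constant [4 * C * d], which is at most 1/4 by this choice. *)
have [d [d0 dr dC]] : exists d : R[i], [/\ 0 < d, d <= r & 16 * C * d <= 1].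
  have p0 : 0 < (16 * C + 1)^-1 by rewrite invr_gt0 ltr_wpDl// mulr_ge0.
  have [rp|pr] := real_leP (gtr0_real r0) (gtr0_real p0).
    exists r; split=> //; rewrite -[leRHS](mulVf (lt0r_neq0 p0)) invrK.
    by rewrite ler_pM ?mulr_ge0// ?lerDl// ltW.
  exists (16 * C + 1)^-1; split=> //; first exact: ltW.
  by rewrite ler_pdivrMr ?mul1r ?lerDl// ltr_wpDl// mulr_ge0.
pose phi n x := S n x - x.
have pphi n : poly_map (phi n).
  by apply: poly_mapB => //; exact: (poly_map_blin (blin_id X)).
have d2 : d / 2 < r by rewrite (lt_le_trans _ dr)// gtr_pMr// invf_lt1 ?ltr1n.
have lip n x y : `|x| < d / 8 -> `|y| < d / 8 ->
    `|phi n y - phi n x| <= 4^-1 * `|y - x|.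
  move=> xd yd; have [->|yx] := eqVneq y x.
    by rewrite !subrr !normr0 mulr0.
  have yx0 : 0 < `|y - x| by rewrite normr_gt0 subr_eq0.
  have yxd : `|y - x| <= d / 4.
    rewrite (le_trans (ler_normB _ _))// (_ : d / 4 = d / 8 + d / 8); last by field.
    by rewrite lerD// ltW.
  have phiM z : `|z| < d -> `|phi n z| <= C * d ^+ 2.
    move=> zd; rewrite (le_trans (Sid n z (lt_le_trans zd dr)))// ler_wpM2l//.
    by rewrite lerXn2r ?nnegrE//; exact: ltW.
  have xd2 : `|x| < d / 2.
    by rewrite (lt_trans xd)// ltr_pM2l// ltf_pV2 ?posrE// ltr_nat.
  have dn0 := lt0r_neq0 d0.
  have q1 : 2 / d * `|y - x| <= 2^-1.
    rewrite (le_trans (ler_wpM2l _ yxd))//; first by rewrite divr_ge0// ltW.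
    by rewrite (_ : 2 / d * (d / 4) = 2^-1)//; field.
  have q2 : `|y - x| <= 2 / d * `|y - x| * (d / 2).
    by rewrite (_ : 2 / d * _ * _ = `|y - x|)//; field.
  have q0 : 0 < 2 / d * `|y - x| by rewrite mulr_gt0// divr_gt0.
  have := poly_map_lipschitz_le (pphi n) d0 phiM xd2 q0 q1 q2.
  rewrite [x + _]addrC subrK => /le_trans; apply.
  rewrite [leLHS](_ : _ = 16 * C * d * (4^-1 * `|y - x|)); last by field.
  by rewrite ler_piMl// mulr_ge0// invr_ge0.
have S0 n : S n 0 = 0.
  apply/eqP; rewrite -normr_le0 -{1}(subr0 (S n 0)).
  by rewrite (le_trans (Sid n 0 _))// normr0 // expr0n/= mulr0.
have phi0 n : phi n 0 = 0 by rewrite /phi S0 subr0.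
pose G := fix G n y := if n is n'.+1 then y - phi n' (G n' y) else 0 : X.
have pG n : poly_map (G n).
  elim: n => [|n IH]; first exact: poly_map_cst.
  apply: poly_mapB; first exact: (poly_map_blin (blin_id X)).
  exact: (poly_map_comp (pphi n) IH).
have d8 : 0 < d / 8 by rewrite divr_gt0.
have h2 : 0 <= 2^-1 :> R[i] by rewrite invr_ge0.
have d16 (y : X) : `|y| < d / 16 -> 2 * `|y| < d / 8.
  by move=> yd; rewrite (_ : d / 8 = 2 * (d / 16)) ?ltr_pM2l//; field.
(* The induction keeps the iterates in the ball of radius [d / 8] where [lip] applies: a quarter of
   [2 * |y|] added to [|y|] stays below [2 * |y|]. *)
have Gle n y : `|y| < d / 16 -> `|G n y| <= 2 * `|y|.
  move=> yd; elim: n => [|n IH]; first by rewrite normr0 mulr_ge0.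
  rewrite /= (le_trans (ler_normB _ _))// mulr_natl mulr2n lerD//.
  have z8 : `|0 : X| < d / 8 by rewrite normr0.
  have := lip n _ _ z8 (le_lt_trans IH (d16 _ yd)).
  rewrite phi0 !subr0 => /le_trans; apply.
  have q4 : 0 <= 4^-1 :> R[i] by rewrite invr_ge0.
  rewrite (le_trans (ler_wpM2l q4 IH))// mulrA ler_piMl//.
  by rewrite ler_pdivrMl// mulr1 ler_nat.
have Gs n y : `|y| < d / 16 -> `|G n y| < d / 8.
  by move=> yd; exact: le_lt_trans (Gle _ _ yd) (d16 _ yd).
have d8r : d / 8 < r.
  by rewrite (lt_trans _ d2)// ltr_pM2l// ltf_pV2 ?posrE// ltr_nat.
(* The induction on the increments needs [C + A / 4 <= A / 2], where [C] is the cost of replacing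
   S_n by S_{n+1}; hence [4 * C]. The summand [d] covers the first increment, which is [y]. *)
pose A := 4 * C + d.
have A0 : 0 <= A by rewrite addr_ge0 ?mulr_ge0// ltW.
have Gstep n y : `|y| < d / 16 -> `|G n.+1 y - G n y| <= A * 2^-1 ^+ n.
  move=> yd; elim: n => [|n IH].
    rewrite /= phi0 !subr0 mulr1 (le_trans (ltW yd))// ler_wpDl ?mulr_ge0//.
    by rewrite ler_piMr ?invf_le1 ?ler1n// ltW.
  have -> : G n.+2 y - G n.+1 y = phi n (G n y) - phi n.+1 (G n.+1 y).
    transitivity ((y - phi n.+1 (G n.+1 y)) - (y - phi n (G n y))); first by [].
    by rewrite [- (y - _)]opprB [LHS]addrC subrKA.
  rewrite distrC.
  rewrite -(subrKA (phi n (G n.+1 y))) (le_trans (ler_normD _ _))//.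
  have b1 : `|phi n.+1 (G n.+1 y) - phi n (G n.+1 y)| <= C * 2^-1 ^+ n.
    rewrite /phi [- (S n _ - _)]opprB subrKA.
    by apply: Srate => //; exact: lt_trans (Gs _ _ yd) d8r.
  have b2 := le_trans (lip n _ _ (Gs n y yd) (Gs n.+1 y yd))
    (ler_wpM2l _ IH).
  rewrite (le_trans (lerD b1 (b2 _))) ?invr_ge0//.
  rewrite exprS mulrA mulrA -mulrDl ler_wpM2r ?exprn_ge0//.
  rewrite -subr_ge0 (_ : _ - _ = d / 4); first by rewrite divr_ge0// ltW.
  by rewrite /A; field.
have Gtail n m y : `|y| < d / 16 -> (n <= m)%N ->
    `|G m y - G n y| <= 2 * A * 2^-1 ^+ n.
  move=> yd nm.
  have tel k : \sum_(i < k) (G i.+1 y - G i y) = G k y.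
    elim: k => [|k IH]; first by rewrite big_ord0.
    by rewrite big_ord_recr IH [LHS]addrC; exact: subrK.
  rewrite -(tel m) -(tel n).
  apply: (@sum_tail_le _ _ (fun i => G i.+1 y - G i y)) => // i _.
  exact: Gstep.
have A2 : 0 <= 2 * A by rewrite mulr_ge0.
have /choice[h Gh] y : exists l : X, `|y| < d / 16 -> G n y @[n --> \oo] --> l.
  have [yd|] := boolP (`|y| < d / 16); last by exists 0.
  have [|l Gl] := @seq_complete_complete _ X (fun n => G n y); last by exists l.
  move=> e e0; have [|N _ NA] := geometric_near_le A2 (_ : 0 < e / 2).
    by rewrite divr_gt0.
  exists N => m n Nm Nn.
  rewrite -(subrKA (G N y)) (le_trans (ler_normD _ _))// [leRHS]splitr lerD//.
    exact: le_trans (Gtail _ _ _ yd Nm) (NA N (leqnn N)).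
  by rewrite distrC; exact: le_trans (Gtail _ _ _ yd Nn) (NA N (leqnn N)).
have hG n y : `|y| < d / 16 -> `|h y - G n y| <= 2 * A * 2^-1 ^+ n.
  move=> yd; apply: (@limit_norm_le _ _ (fun m => G m y - G n y)).
    by apply: cvgB; [exact: Gh|exact: cvg_cst].
  by exists n => // m /= nm; exact: Gtail.
have hle y : `|y| < d / 16 -> `|h y| <= 2 * `|y|.
  move=> yd; apply: limit_norm_le (Gh y yd) _.
  by apply: nearW => n; exact: Gle.
have fh y : `|y| < d / 16 -> f (h y) = y.
  move=> yd; apply/eqP; rewrite -subr_eq0 -normr_le0; apply/ler_addgt0Pr => e e0.
  have hd8 : `|h y| < d / 8 := le_lt_trans (hle _ yd) (d16 _ yd).
  have e4 : 0 < e / 4 by rewrite divr_gt0.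
  near \oo => n; rewrite add0r.
  have b1 : `|f (h y) - S n (h y)| <= e / 4.
    have : `|h y| < r by exact: lt_trans hd8 d8r.
    by move: (h y); near: n; exact: approx_unif Sf _ e4.
  have b2 : A * 2^-1 ^+ n <= e / 4 by near: n; exact: geometric_near_le.
  have b3 : 2 * A * 2^-1 ^+ n <= e / 4 by near: n; exact: geometric_near_le.
  have -> : f (h y) - y = (f (h y) - S n (h y)) + (phi n (h y) - phi n (G n y))
      + ((h y - G n y) - (G n.+1 y - G n y)).
    exact: residual_split.
  rewrite (le_trans (ler_normD _ _))//.
  rewrite (le_trans (lerD (ler_normD _ _) (ler_normB _ _)))//.
  have hGn := hG n y yd.
  rewrite (_ : e = e / 4 + e / 4 + (e / 4 + e / 4)); last by field.
  rewrite !lerD//.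
  - rewrite (le_trans (lip n _ _ (Gs n y yd) hd8))// (le_trans _ b3)//.
    rewrite (le_trans _ hGn)// ler_piMl// invf_le1 ?ler1n//.
  - exact: le_trans hGn b3.
  exact: le_trans (Gstep n y yd) b2.
have [e /= e0 eU] : exists2 e : R[i], 0 < e & forall x, `|x| < e -> U x.
  by have /nbhs_norm0P[e] := open_nbhs_nbhs (conj oU U0); exists e.
have [s [s0 sd se]] : exists s : R[i], [/\ 0 < s, s <= d / 16 & 2 * s <= e].
  have [de|ed] := real_leP (gtr0_real (divr_gt0 d0 (ltr0n _ 16)))
                           (gtr0_real (divr_gt0 e0 (ltr0n _ 2))).
    exists (d / 16); split; rewrite ?divr_gt0//.
    by rewrite mulrC -ler_pdivlMr.
  exists (e / 2); split; rewrite ?divr_gt0//; first exact: ltW.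
  by rewrite mulrC divfK ?pnatr_eq0.
(* The values [h y] lie in [U], where [g] undoes [f], so [g y = g (f (h y)) = h y]. *)
have gh y : `|y| < s -> g y = h y.
  move=> ys; have yd := lt_le_trans ys sd.
  rewrite -[in LHS](fh y yd) fgK// inE; apply: eU.
  by rewrite (le_lt_trans (hle _ yd))// (lt_le_trans _ se)// ltr_pM2l.
exists G, s; split=> //; split=> //.
  exists (d / 8) => n y ys; exact/ltW/Gs/(lt_le_trans ys sd).
move=> e1 e10; apply: filterS (geometric_near_le A2 e10) => n ne y ys.
by rewrite gh// (le_trans (hG _ _ _))// (lt_le_trans ys sd).
Unshelve. all: by end_near. Qed.

End LocalInverse.

(** * Derivatives of the inverse up to order three *)

Section InverseDerivatives.
Context {R : realType}.

Lemma near_norm_lt (V : normedModType R[i]) (x : V) (r : R[i]) :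
  `|x| < r -> \forall y \near x, `|y| < r.
Proof.
move=> xr; apply/nbhs_normP; exists (r - `|x|); first by rewrite /= subr_gt0.
move=> y /=; rewrite ltrBrDl => yr.
rewrite -(subKr x y) (le_lt_trans (ler_normB _ _))//.
Qed.

Lemma dblin_app (V W P : normedModType R[i]) (A : V -> blin W P) (b : V -> W) x :
  differentiable A x -> differentiable b x ->
  differentiable (fun y => A y (b y)) x /\
  forall u, dblin (fun y => A y (b y)) x u
            = dblin A x u (b x) + A x (dblin b x u).
Proof.
move=> dA db; split; first exact: (differentiable_bbil (blin_eval W P) dA db).
by move=> u; rewrite (dblin_bbil (blin_eval W P) dA db).
Qed.

Lemma dblin_app_cst (V W P : normedModType R[i]) (A : V -> blin W P) w x :
  differentiable A x ->
  differentiable (fun y => A y w) x /\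
  forall u, dblin (fun y => A y w) x u = dblin A x u w.
Proof.
move=> dA; have [dAw AwE] := dblin_app dA (differentiable_cst w x).
split=> // u; rewrite AwE (hasD_dblin (hasD_cst _ _)).
by rewrite blin0E linear0 addr0.
Qed.

Lemma dblin_near (V W : normedModType R[i]) (F G : V -> W) x :
  (\forall y \near x, F y = G y) -> differentiable F x ->
  dblin F x = dblin G x.
Proof.
by move=> FG dF; apply/esym/hasD_dblin/(hasD_near FG)/differentiable_hasD.
Qed.

Definition smooth3_near (V W : normedModType R[i]) (F : V -> W) (r : R[i]) :=
  forall x, `|x| < r -> [/\ differentiable F x, differentiable (dblin F) x &
    differentiable (dblin (dblin F)) x].

(** Each of three applications of [approx_dblin] halves the radius, whence [r / 8]. *)
Lemma approx_smooth3 (V W : normedModType R[i]) Fn (F : V -> W) r :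
  seq_complete W -> 0 < r -> poly_approx Fn F r -> smooth3_near F (r / 8).
Proof.
move=> cW r0 aF.
have r20 : 0 < r / 2 by rewrite divr_gt0.
have r40 : 0 < r / 2 / 2 by rewrite divr_gt0.
have [dF aDF] := approx_dblin cW r0 aF.
have cL := seq_complete_blin (V := V) cW.
have [dDF aDDF] := approx_dblin cL r20 aDF.
have [dDDF _] := approx_dblin (seq_complete_blin cL) r40 aDDF.
have r8 : r / 8 = r / 2 / 2 / 2 by field.
have r82 : r / 8 <= r / 2 / 2.
  by rewrite r8 ler_piMr ?invf_le1 ?ler1n// ltW.
have r83 : r / 8 <= r / 2.
  by rewrite (le_trans r82)// ler_piMr ?invf_le1 ?ler1n// ltW.
move=> x xr; split; first exact/dF/(lt_le_trans xr).
  exact/dDF/(lt_le_trans xr).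
by apply: dDDF; rewrite -r8.
Qed.

Lemma approx_sym_hess (V W : normedModType R[i]) Fn (F : V -> W) r u v :
  seq_complete W -> 0 < r -> poly_approx Fn F r ->
  (forall n, sym_hess (Fn n)) ->
  dblin (dblin F) 0 u v = dblin (dblin F) 0 v u.
Proof.
move=> cW r0 aF sF.
have r20 : 0 < r / 2 by rewrite divr_gt0.
have [_ aDF] := approx_dblin cW r0 aF.
have [_ aDDF] := approx_dblin (seq_complete_blin (V := V) cW) r20 aDF.
have z0 : `|0 : V| < r / 2 / 2 by rewrite normr0 divr_gt0.
have cv := approx_cvg aDDF z0.
have c1 := cvg_blin_app (x := v) (cvg_blin_app (x := u) cv).
have c2 := cvg_blin_app (x := u) (cvg_blin_app (x := v) cv).
apply: (cvg_unique _ c1) => //.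
by rewrite (_ : (fun n => _) = fun n => dblin (dblin (Fn n)) 0 v u)//;
  apply/funext => n; exact: sF.
Qed.

Section left_inverse.
Variables (X : normedModType R[i]) (f g : X -> X) (r s : R[i]).
Hypotheses (r0 : 0 < r) (sf : smooth3_near f r) (sg : smooth3_near g s).
Hypothesis fr : forall x, `|x| < r -> `|f x| < s.
Hypothesis fgK : forall x, `|x| < r -> g (f x) = x.
Hypotheses (f0 : f 0 = 0) (Df0 : forall v, dblin f 0 v = v).

Let sgf x : `|x| < r -> [/\ differentiable g (f x), differentiable (dblin g) (f x) &
    differentiable (dblin (dblin g)) (f x)].
Proof. by move=> xr; exact/sg/fr. Qed.

Let Df := dblin f.
Let Dg := dblin g.
Let DDf := dblin Df.
Let DDg := dblin Dg.

Lemma left_inverse_dblin x v : `|x| < r -> Dg (f x) (Df x v) = v.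
Proof.
move=> xr; have [df _ _] := sf xr; have [dg _ _] := sgf xr.
have gfE : \forall y \near x, g (f y) = blin_id X y.
  by have := near_norm_lt xr; apply: filterS => y; exact: fgK.
have dgf : differentiable (fun y => g (f y)) x := differentiable_comp df dg.
have := dblin_near gfE dgf; rewrite (hasD_dblin (hasD_blin _ _)) dblin_comp//.
by move=> /(congr1 (fun T : blin X X => T v)).
Qed.

Lemma left_inverse_dblin2 x u v : `|x| < r ->
  DDg (f x) (Df x u) (Df x v) + Dg (f x) (DDf x u v) = 0.
Proof.
move=> xr; have [df dDf _] := sf xr; have [_ dDg _] := sgf xr.
have E : \forall y \near x, Dg (f y) (Df y v) = v.
  by have := near_norm_lt xr; apply: filterS => y; exact: left_inverse_dblin.
have [dv vE] := dblin_app_cst v dDf.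
have dDgf : differentiable (fun y => Dg (f y)) x := differentiable_comp df dDg.
have [dA AE] := dblin_app dDgf dv.
have := dblin_near E dA; rewrite (hasD_dblin (hasD_cst _ _)).
move=> /(congr1 (fun T : blin X X => T u)); rewrite AE vE dblin_comp//.
Qed.

Lemma left_inverse_DDg u v : DDg 0 u v = - DDf 0 u v.
Proof.
have z : `|0 : X| < r by rewrite normr0.
have := left_inverse_dblin (DDf 0 u v) z; rewrite f0 Df0 => D1.
have := left_inverse_dblin2 u v z; rewrite f0 !Df0 D1 => /eqP.
by rewrite addr_eq0 => /eqP.
Qed.

(** The second-order identity is differentiated at 0 only, where [f 0 = 0] and Df(0) = id remove all
    chain-rule factors; Dg(0) = id then follows from the first-order identity. *)
Lemma left_inverse_dblin3 w :
  dblin DDg 0 w w w + DDg 0 (DDf 0 w w) w + DDg 0 w (DDf 0 w w)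
  + (DDg 0 w (DDf 0 w w) + dblin DDf 0 w w w) = 0.
Proof.
have z : `|0 : X| < r by rewrite normr0.
have [df dDf dDDf] := sf z; have [_ dDg dDDg] := sgf z.
have E : \forall y \near 0,
    DDg (f y) (Df y w) (Df y w) + Dg (f y) (DDf y w w) = 0.
  by have := near_norm_lt z; apply: filterS => y; exact: left_inverse_dblin2.
have [da aE] := dblin_app_cst w dDf.
have [dc cE] := dblin_app_cst w dDDf.
have [dc' cE'] := dblin_app_cst w dc.
have dDgf : differentiable (fun y => Dg (f y)) 0 := differentiable_comp df dDg.
have dDDgf : differentiable (fun y => DDg (f y)) 0 := differentiable_comp df dDDg.
have [dM ME] := dblin_app dDDgf da.
have [dN NE] := dblin_app dM da.
have [dL LE] := dblin_app dDgf dc'.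
have := dblin_near E (differentiableD dN dL).
rewrite (hasD_dblin (hasD_cst _ _)) dblinD//.
move=> /(congr1 (fun T : blin X X => T w)) H.
have e1 : dblin (fun y => Dg (f y)) 0 w = DDg 0 w.
  by rewrite dblin_comp// -[in RHS]f0 -[in RHS](Df0 w).
have e2 : dblin (fun y => DDg (f y)) 0 w = dblin DDg 0 w.
  by rewrite dblin_comp// -[in RHS]f0 -[in RHS](Df0 w).
have e3 : Dg (f 0) (dblin DDf 0 w w w) = dblin DDf 0 w w w.
  by have := left_inverse_dblin (dblin DDf 0 w w w) z; rewrite Df0.
rewrite -[RHS]H [RHS]blinDE (NE w) (LE w) (ME w) (aE w) (cE' w) (cE w) e1 e2 e3.
by rewrite (Df0 w) f0.
Qed.

(** Since D^2 g(0) = - D^2 f(0), each of the three mixed terms is the negative of D^2 f(0)[w, D^2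
    f(0)[w, w]]; symmetry is used for the one whose arguments come in the other order. *)
Lemma left_inverse_DDDg w :
  (forall u v, DDf 0 u v = DDf 0 v u) ->
  dblin DDg 0 w w w = DDf 0 w (DDf 0 w w) *+ 3 - dblin DDf 0 w w w.
Proof.
move=> sDDf; have := left_inverse_dblin3 w.
rewrite !left_inverse_DDg (sDDf (DDf 0 w w) w).
set a := DDf 0 w _; set t := dblin DDf _ _ _ _; set q := dblin DDg _ _ _ _.
move=> /eqP; rewrite addrA addr_eq0 => /eqP <-.
by rewrite !mulrS mulr0n addr0 [RHS]addrC !addrA !subrK.
Qed.

End left_inverse.

(** In the limit the quadratic estimate for the partial sums reads [|f x - x| <= C * |x| ^+ 2] near
    0, which contains both the value and the derivative at 0. *)
Lemma normalized_expansion_id (X : completeNormedModType R[i]) (f : X -> X) :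
  holomorphic_near0 f -> normalized_expansion f ->
  f 0 = 0 /\ hasD f 0 (blin_id X).
Proof.
move=> hf hexp; have [r [C [r0 C0 Sf Sid _]]] := hom_sum_approx hf hexp.
have fid x : `|x| < r -> `|f x - x| <= C * `|x| ^+ 2.
  move=> xr; apply: (@limit_norm_le _ _ (fun n => hom_sum f n x - x)).
    by apply: cvgB; [exact: approx_cvg Sf xr|exact: cvg_cst].
  by apply: nearW => n; exact: Sid.
have f0 : f 0 = 0.
  apply/eqP; rewrite -normr_le0 -{1}(subr0 (f 0)).
  by rewrite (le_trans (fid 0 _)) ?normr0// expr0n/= mulr0.
split=> // e e0; near=> h.
have hr : `|h| < r by near: h; exact: nbhs0_lt.
have hC : `|h| <= e / (C + 1).
  by near: h; apply: nbhs0_le; rewrite divr_gt0// ltr_wpDl.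
rewrite add0r f0 subr0 (le_trans (fid h hr))// expr2 mulrA ler_wpM2r//.
rewrite (le_trans (ler_wpM2l C0 hC))// mulrA ler_pdivrMr ?ltr_wpDl//.
by rewrite mulrC ler_wpM2l ?lerDl// ltW.
Unshelve. all: by end_near. Qed.

Lemma inverse_derivatives (X : completeNormedModType R[i]) (f g : X -> X) :
  holomorphic_near0 f -> normalized_expansion f -> local_inverse f g ->
  [/\ forall u v, dblin (dblin g) 0 u v = - dblin (dblin f) 0 u v &
      forall w, dblin (dblin (dblin g)) 0 w w w =
        dblin (dblin f) 0 w (dblin (dblin f) 0 w w) *+ 3
        - dblin (dblin (dblin f)) 0 w w w].
Proof.
move=> hf hexp hg; have [f0 Df] := normalized_expansion_id hf hexp.
have cX := @seq_complete_complete _ X.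
have [d [C [d0 _ Sf _ _]]] := hom_sum_approx hf hexp.
have [Gn [s [s0 Sg]]] := local_inverse_approx hf hexp hg.
have sf := approx_smooth3 cX d0 Sf.
have sg := approx_smooth3 cX s0 Sg.
have d8 : 0 < d / 8 by rewrite divr_gt0.
have s8 : 0 < s / 8 by rewrite divr_gt0.
have fc : {for 0, continuous f}.
  by apply: differentiable_continuous; exact: hasD_differentiable Df.
have [U [V [[oU U0] _ _ fgK]]] := hg.
have /nbhs_norm0P[r /= r0 rP] : \forall x \near 0,
    [/\ `|x| < d / 8, `|f x| < s / 8 & g (f x) = x].
  near=> x; split.
  - by near: x; exact: nbhs0_lt.
  - rewrite -[f x]subr0 -normrN opprB -f0; near: x.
    by move/cvgrPdist_lt: fc; exact.
  apply: fgK; rewrite inE; near: x; exact: open_nbhs_nbhs.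
have sfr : smooth3_near f r by move=> x /rP[/sf].
have frs x : `|x| < r -> `|f x| < s / 8 by case/rP.
have gfr x : `|x| < r -> g (f x) = x by case/rP.
have Df0 v : dblin f 0 v = v by rewrite (hasD_dblin Df).
split=> [u v|w]; first exact: left_inverse_DDg r0 sfr sg frs gfr f0 Df0 u v.
apply: (left_inverse_DDDg r0 sfr sg frs gfr f0 Df0) => u v.
by apply: (approx_sym_hess u v cX d0 Sf) => n; have [] := hom_sum_poly f n.
Unshelve. all: by end_near. Qed.

End InverseDerivatives.

(** * Taylor polynomials of the inverse and the Fekete-Szego identities *)

Lemma nderiv2E (R : realType) (X : normedModType R[i]) (f : X -> X) u v :
  nderiv f 0 [tuple u; v] = dblin (dblin f) 0 u v.
Proof. by []. Qed.

Lemma taylor_poly2E (R : realType) (X : normedModType R[i]) (f : X -> X) x :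
  taylor_poly f 2 x = 2^-1 *: dblin (dblin f) 0 x x.
Proof. by []. Qed.

Lemma taylor_poly3E (R : realType) (X : normedModType R[i]) (f : X -> X) x :
  taylor_poly f 3 x = 6^-1 *: dblin (dblin (dblin f)) 0 x x x.
Proof. by []. Qed.

Lemma taylor_poly_scale (R : realType) (X : normedModType R[i]) (f : X -> X)
    k a x : taylor_poly f k (a *: x) = a ^+ k *: taylor_poly f k x.
Proof.
by rewrite /taylor_poly [nderiv _ _ _]mlin_diag_scale scalerA mulrC -scalerA.
Qed.

(** The factor 3/6 in the third-order formula is the 1/2 of P_2, so D^2 f(0)[e, P_2(e)] appears with
    coefficient 1. In the second equation the signs of D^2 g(0) and of P_2 for [g] cancel. *)
Lemma taylor_poly_inverse (R : realType) (X : completeNormedModType R[i])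
    (f g : X -> X) e :
  holomorphic_near0 f -> normalized_expansion f -> local_inverse f g ->
  [/\ taylor_poly g 2 e = - taylor_poly f 2 e,
      nderiv g 0 [tuple e; taylor_poly g 2 e]
        = nderiv f 0 [tuple e; taylor_poly f 2 e] &
      taylor_poly g 3 e = nderiv f 0 [tuple e; taylor_poly f 2 e]
                          - taylor_poly f 3 e].
Proof.
move=> hf hexp hg; have [g2 g3] := inverse_derivatives hf hexp hg.
have P2 : taylor_poly g 2 e = - taylor_poly f 2 e.
  by rewrite !taylor_poly2E g2 scalerN.
split=> //; first by rewrite !nderiv2E P2 g2 linearN opprK.
rewrite !taylor_poly3E g3 scalerBr nderiv2E taylor_poly2E; congr (_ - _).
rewrite -[X in _ *: X]scaler_nat scalerA [RHS](bbilZr (blin_eval X X)); congr (_ *: _).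
by field.
Qed.

Unset Implicit Arguments.

Theorem proposition4p2 (R : realType) (X : completeNormedModType R[i])
    (f g : X -> X) (hf : holomorphic_near0 f)
    (hexp : normalized_expansion f) (hg : local_inverse f g) :
  (forall (lambda mu : R[i]) (e : X) (es : dual X),
     `|e| = 1 -> duality e es ->
     fekete_szego g lambda mu e es
       = - fekete_szego f (2 - lambda) (2 - mu) e es) /\
  (forall (x : X) (es : dual X), x != 0 ->
     (3`!)%:R^-1 *: nderiv g 0 [tuple of nseq 3 x]
       = - (`|x| ^+ 3 *: fekete_szego f 2 2 (`|x|^-1 *: x) es)).
Proof.
split=> [lambda mu e es _ _|x es x0].
  have [P2 D2 P3] := taylor_poly_inverse e hf hexp hg.
  rewrite /fekete_szego D2 P3 P2.
  set W := nderiv f _ _; set Z := taylor_poly f 2 e; set T := taylor_poly f 3 e.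
  have -> : es (- Z) = - (es Z : R[i]) by exact: (bbilNr (blin_eval X R[i]^o)).
  (* The 1 accounts for the term [W] contributed by P_3 of [g]; this is the origin of the shift from
     [mu] to [2 - mu]. In the last term of the functional the two signs from P_2 of [g] cancel, in
     agreement with [- (lambda - mu)] under the overall minus sign. *)
  rewrite (_ : (2 - mu) / 2 = 1 - mu / 2); last by field.
  rewrite (_ : 2 - lambda - (2 - mu) = - (lambda - mu)); last by ring.
  rewrite scalerBl scale1r mulrN mulNr !scaleNr scalerN !opprK.
  by rewrite !opprD !opprK addrA [- T + W]addrC.
have nx : `|x| != 0 by rewrite normr_eq0.
have -> : (3`!)%:R^-1 *: nderiv g 0 [tuple of nseq 3 x] = taylor_poly g 3 x by [].
set e := `|x|^-1 *: x.
have xE : x = `|x| *: e by rewrite scalerA mulfV// scale1r.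
have [_ _ P3] := taylor_poly_inverse e hf hexp hg.
have -> : taylor_poly g 3 x = `|x| ^+ 3 *: taylor_poly g 3 e.
  by rewrite -taylor_poly_scale -xE.
rewrite P3 -[RHS]scalerN; congr (_ *: _).
(* At parameters 2, 2 the coefficient of the functional is 0 and that of D^2 f(0)[e, P_2(e)] is 1,
   which leaves the negative of P_3 of [g] at [e]. *)
rewrite /fekete_szego subrr mul0r scale0r subr0 divff ?pnatr_eq0// scale1r.
by rewrite opprB.
Qed.
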